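(* Let $\Gamma$ be a nonelementary discrete subgroup of $\mathrm{Sp}(n,1)$ whose trace field is contained in $\mathbb R$. Then $\Gamma$ is conjugate (in $\mathrm{Sp}(n,1)$) to a subgroup of $\mathrm{Sp}(n-m)\oplus\mathrm{O}(m,1)$ for some $m\ge 2$, or to a subgroup of $\mathrm{Sp}(n-1)\oplus\mathrm{SU}(1,1)$.
   Context: $\mathbb H$ denotes the quaternions. $\mathrm{Sp}(n,1)=\{A\in\mathrm{GL}(n+1,\mathbb H): A^*I_{n,1}A=I_{n,1}\}$ with $A^*$ the conjugate transpose and $I_{n,1}=\mathrm{diag}(1,\dots,1,-1)$, acting on quaternionic hyperbolic space $\mathbf H^n_{\mathbb H}$; nonelementary means the limit set in $\partial\mathbf H^n_{\mathbb H}$ has more than two points. $\mathrm{Sp}(k)$ is the group of $k\times k$ quaternionic matrices preserving the standard positive definite form; $\mathrm{O}(m,1)$ is the group of real matrices preserving $\mathrm{diag}(1,\dots,1,-1)$; $\mathrm{SU}(1,1)$ is the group of complex $2\times 2$ matrices of determinant $1$ preserving $\mathrm{diag}(1,-1)$. $A\oplus B$ denotes block diagonal matrices with $A$ in the upper left and $B$ in the lower right block. The trace of a matrix is the sum of its diagonal entries; the trace field of $\Gamma$ is the skew field generated over $\mathbb Q$ by the traces of its elements. *)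

(* Defs.v *)
From HB Require Import structures.
From mathcomp Require Import all_boot all_order all_algebra.
From mathcomp Require Import ring.
From mathcomp Require Import reals.
From mathcomp Require Import complex.

Set Implicit Arguments.
Unset Strict Implicit.
Unset Printing Implicit Defensive.

Import Order.TTheory GRing.Theory Num.Theory.
Local Open Scope ring_scope.

(** * Quaternions  q = a + b i + c j + d k  over a commutative ring R  *)

Variant quat (R : Type) := Quat of R & R & R & R.

Definition qa {R} (q : quat R) := let: Quat a _ _ _ := q in a.
Definition qb {R} (q : quat R) := let: Quat _ b _ _ := q in b.
Definition qc {R} (q : quat R) := let: Quat _ _ c _ := q in c.
Definition qd {R} (q : quat R) := let: Quat _ _ _ d := q in d.

Section QuatRing.
Variable R : comNzRingType.

Definition quat2tuple (q : quat R) := (qa q, qb q, qc q, qd q).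
Definition tuple2quat (t : R * R * R * R) :=
  let: (a, b, c, d) := t in Quat a b c d.
Lemma quat2tupleK : cancel quat2tuple tuple2quat.
Proof. by case. Qed.

HB.instance Definition _ := Choice.copy (quat R) (can_type quat2tupleK).

Definition qzero : quat R := Quat 0 0 0 0.
Definition qone : quat R := Quat 1 0 0 0.
Definition qadd (x y : quat R) :=
  Quat (qa x + qa y) (qb x + qb y) (qc x + qc y) (qd x + qd y).
Definition qopp (x : quat R) := Quat (- qa x) (- qb x) (- qc x) (- qd x).
(* Hamilton product: i^2 = j^2 = k^2 = ijk = -1 *)
Definition qmul (x y : quat R) :=
  let: Quat a1 b1 c1 d1 := x in let: Quat a2 b2 c2 d2 := y in
  Quat (a1 * a2 - b1 * b2 - c1 * c2 - d1 * d2)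
       (a1 * b2 + b1 * a2 + c1 * d2 - d1 * c2)
       (a1 * c2 - b1 * d2 + c1 * a2 + d1 * b2)
       (a1 * d2 + b1 * c2 - c1 * b2 + d1 * a2).

Lemma qaddA : associative qadd.
Proof. by case=> ? ? ? ? [? ? ? ?] [? ? ? ?]; rewrite /qadd /qopp /qmul /qzero /qone /=; congr Quat; ring. Qed.
Lemma qaddC : commutative qadd.
Proof. by case=> ? ? ? ? [? ? ? ?]; rewrite /qadd /qopp /qmul /qzero /qone /=; congr Quat; ring. Qed.
Lemma qadd0 : left_id qzero qadd.
Proof. by case=> ? ? ? ?; rewrite /qadd /qopp /qmul /qzero /qone /=; congr Quat; ring. Qed.
Lemma qaddN : left_inverse qzero qopp qadd.
Proof. by case=> ? ? ? ?; rewrite /qadd /qopp /qmul /qzero /qone /=; congr Quat; ring. Qed.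

HB.instance Definition _ := GRing.isZmodule.Build (quat R) qaddA qaddC qadd0 qaddN.

Lemma qmulA : associative qmul.
Proof. by case=> ? ? ? ? [? ? ? ?] [? ? ? ?]; rewrite /qadd /qopp /qmul /qzero /qone /=; congr Quat; ring. Qed.
Lemma qmul1 : left_id qone qmul.
Proof. by case=> ? ? ? ?; rewrite /qadd /qopp /qmul /qzero /qone /=; congr Quat; ring. Qed.
Lemma qmulr1 : right_id qone qmul.
Proof. by case=> ? ? ? ?; rewrite /qadd /qopp /qmul /qzero /qone /=; congr Quat; ring. Qed.
Lemma qaddE (x y : quat R) : x + y = qadd x y. Proof. by []. Qed.
Lemma qmulDl : left_distributive qmul +%R.
Proof. by case=> ? ? ? ? [? ? ? ?] [? ? ? ?]; rewrite !qaddE /qadd /qmul /=; congr Quat; ring. Qed.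
Lemma qmulDr : right_distributive qmul +%R.
Proof. by case=> ? ? ? ? [? ? ? ?] [? ? ? ?]; rewrite !qaddE /qadd /qmul /=; congr Quat; ring. Qed.
Lemma qone_neq0 : qone != 0.
Proof.
apply/eqP => /(congr1 qa) /= /eqP; by rewrite oner_eq0.
Qed.

HB.instance Definition _ :=
  GRing.Zmodule_isNzRing.Build (quat R) qmulA qmul1 qmulr1 qmulDl qmulDr qone_neq0.

Definition qconj (q : quat R) := Quat (qa q) (- qb q) (- qc q) (- qd q).
Definition qnorm2 (q : quat R) : R :=
  qa q ^+ 2 + qb q ^+ 2 + qc q ^+ 2 + qd q ^+ 2.

Definition qreal (r : R) : quat R := Quat r 0 0 0.
Definition qcplx (z : R[i]) : quat R := Quat (complex.Re z) (complex.Im z) 0 0.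
Definition is_qreal (q : quat R) : Prop := q = qreal (qa q).

End QuatRing.

Definition qinv {R : fieldType} (q : quat R) : quat R :=
  let n := qnorm2 q in
  Quat (qa q / n) (- qb q / n) (- qc q / n) (- qd q / n).

Section Groups.
Variable R : realType.
Local Notation H := (quat R).

Definition qadj m n (A : 'M[H]_(m, n)) : 'M[H]_(n, m) :=
  \matrix_(i, j) qconj (A j i).

Definition Jq n : 'M[H]_(n.+1) :=
  \matrix_(i, j) (if i == j then (if i == ord_max then -1 else 1) else 0).
Definition Jr m : 'M[R]_(m.+1) :=
  \matrix_(i, j) (if i == j then (if i == ord_max then -1 else 1) else 0).
Definition Jc : 'M[R[i]]_2 :=
  \matrix_(i, j) (if i == j then (if i == ord_max then -1 else 1) else 0).

Definition in_Sp_n1 n (A : 'M[H]_(n.+1)) : Prop := qadj A *m Jq n *m A = Jq n.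
Definition sp_inv n (A : 'M[H]_(n.+1)) : 'M[H]_(n.+1) := Jq n *m qadj A *m Jq n.

Definition in_Sp k (A : 'M[H]_k) : Prop := qadj A *m A = 1%:M.
Definition in_O_m1 m (A : 'M[R]_(m.+1)) : Prop := A^T *m Jr m *m A = Jr m.
Definition in_SU11 (A : 'M[R[i]]_2) : Prop :=
  \det A = 1 /\ (map_mx conjc A)^T *m Jc *m A = Jc.

Definition in_Sp_plus_O n m (A : 'M[H]_(n.+1)) : Prop :=
  exists (e : ((n - m) + m.+1 = n.+1)%N) (B : 'M[H]_(n - m)) (C : 'M[R]_(m.+1)),
    [/\ in_Sp B, in_O_m1 C &
        A = castmx (e, e) (block_mx B 0 0 (map_mx (@qreal R) C))].

Definition in_Sp_plus_SU11 n (A : 'M[H]_(n.+1)) : Prop :=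
  exists (e : ((n - 1) + 2 = n.+1)%N) (B : 'M[H]_(n - 1)) (C : 'M[R[i]]_2),
    [/\ in_Sp B, in_SU11 C &
        A = castmx (e, e) (block_mx B 0 0 (map_mx (@qcplx R) C))].

Definition subgroup_Sp_n1 n (G : 'M[H]_(n.+1) -> Prop) : Prop :=
  [/\ forall g, G g -> in_Sp_n1 g,
      G 1%:M,
      forall g h, G g -> G h -> G (g *m h) &
      forall g, G g -> G (sp_inv g)].

Definition conj_into n (G K : 'M[H]_(n.+1) -> Prop) : Prop :=
  exists g, in_Sp_n1 g /\ forall x, G x -> K (g *m x *m sp_inv g).

Definition mxdist2 n (A B : 'M[H]_n) : R := \sum_(i < n) \sum_(j < n) qnorm2 (A i j - B i j).
Definition discrete_set n (G : 'M[H]_n -> Prop) : Prop :=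
  forall g, G g -> exists2 eps : R, 0 < eps &
    forall h, G h -> mxdist2 h g < eps -> h = g.

Definition subskewfield (S : H -> Prop) : Prop :=
  [/\ S 1, forall x y, S x -> S y -> S (x - y), forall x y, S x -> S y -> S (x * y)
    & forall x, S x -> x != 0 -> S (qinv x)].
Definition trace_field n (G : 'M[H]_n -> Prop) (q : H) : Prop :=
  forall S, subskewfield S -> (forall g, G g -> S (\tr g)) -> S q.

(** ball model of quaternionic hyperbolic space H^n_H: points z in H^n with
    |z| < 1 correspond to the negative (right) lines spanned by (z,1);
    the boundary is the unit sphere |z| = 1 (null lines). *)
Definition qvnorm2 n (z : 'I_n -> H) : R := \sum_i qnorm2 (z i).
Definition hvec n (z : 'I_n -> H) : 'cV[H]_(n.+1) :=
  \col_i (match unlift ord_max i with Some j => z j | None => 1 end).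
Definition act n (A : 'M[H]_(n.+1)) (z : 'I_n -> H) : 'I_n -> H :=
  fun i => (A *m hvec z) (widen_ord (leqnSn n) i) 0 * qinv ((A *m hvec z) ord_max 0).
Definition origin n : 'I_n -> H := fun _ => 0.

Definition converges n (u : nat -> 'I_n -> H) (l : 'I_n -> H) : Prop :=
  forall eps : R, 0 < eps -> exists N, forall k, (N <= k)%N ->
    qvnorm2 (fun i => u k i - l i) < eps.

Definition limit_set n (G : 'M[H]_(n.+1) -> Prop) (xi : 'I_n -> H) : Prop :=
  qvnorm2 xi = 1 /\
  exists g : nat -> 'M[H]_(n.+1), (forall k, G (g k)) /\
    converges (fun k => act (g k) (@origin n)) xi.

Definition nonelementary n (G : 'M[H]_(n.+1) -> Prop) : Prop :=
  exists x y z, [/\ limit_set G x, limit_set G y, limit_set G z &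
                    [/\ x <> y, y <> z & x <> z]].

End Groups.

(* Main.v *)
Require Import Defs.
From HB Require Import structures.
From mathcomp Require Import all_boot all_order all_algebra.
From mathcomp Require Import reals complex.
From mathcomp Require Import ring lra zify.
From mathcomp Require Import boolp classical_sets filter.
From mathcomp Require Import topology normedtype.

(** The real span A of G is an algebra closed under limits and under the
    adjoint of the Hermitian form.  A limit point of G with lift x yields a
    rank-one element v |-> x <y, v> of A, with y null.  A discrete
    nonelementary group fixes no null line, so multiplying this element, a
    group element and its adjoint gives v |-> x k <x, v> in A with k <> 0; up
    to adjoints, either k = 1, or every such k is imaginary.  Let W = A x, a
    real subspace invariant under G.  Left multiplication by an imaginary
    quaternion q is not conjugation invariant, and the reality of the traces
    says that the operators of A are orthogonal to q, which bounds the possible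
    values of the form on W.  If k = 1 they are real: W has a real orthonormal
    basis of signature (m, 1), on which G acts by O(m, 1).  Otherwise they lie
    on a line of imaginary quaternions: W is a real symplectic plane, and
    SL(2, R) is SU(1, 1) after a Cayley transform. *)

Set Implicit Arguments.
Unset Strict Implicit.
Unset Printing Implicit Defensive.

Import Order.TTheory GRing.Theory Num.Theory.
Import numFieldNormedType.Exports.
Local Open Scope ring_scope.

(** * Quaternions *)

Section Quaternions.
Variable R : realType.
Local Notation H := (quat R).
Implicit Types (x y z u v : H) (r s : R).

(** The rank-one elements come from the dynamics: if [g_k] carries the origin towards a boundary
    point, [g_k] divided by the norm of its corner entry stays bounded, and the image of a limit is
    totally isotropic, hence in signature (n, 1) a single line. The obstacle is that y need not be
    x: without discreteness G may be nonelementary and still fix the line of y, and then <y, g y> =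
    0 for every g. Discreteness excludes this. If some h expands y, conjugating any g by the powers
    of h gives a bounded sequence, which has to repeat, so g fixes both ends of the axis of h; if no
    element expands y, the pairing of y with the orbit of the origin is bounded. Either way at most
    two limit points remain. The form on W is controlled because W is stable under right
    multiplication by k times its values: one forbidden value would make W stable under an imaginary
    v, and the trace conditions for i, j, k then lead to a contradiction. The bound m >= 2 holds
    because every limit point has a lift in W, while R^(1,1) contains only two null lines. *)

Lemma quat_eqP x y : qa x = qa y -> qb x = qb y -> qc x = qc y -> qd x = qd y ->
  x = y.
Proof. by case: x => ? ? ? ?; case: y => ? ? ? ? /= -> -> -> ->. Qed.

Lemma qmulE x y : x * y = qmul x y. Proof. by []. Qed.
Lemma qa_is_zmod_morphism : zmod_morphism (@qa R).
Proof. by case=> ? ? ? ? [? ? ? ?]. Qed.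
Lemma qb_is_zmod_morphism : zmod_morphism (@qb R).
Proof. by case=> ? ? ? ? [? ? ? ?]. Qed.
Lemma qc_is_zmod_morphism : zmod_morphism (@qc R).
Proof. by case=> ? ? ? ? [? ? ? ?]. Qed.
Lemma qd_is_zmod_morphism : zmod_morphism (@qd R).
Proof. by case=> ? ? ? ? [? ? ? ?]. Qed.
HB.instance Definition _ := GRing.isZmodMorphism.Build H R (@qa R) qa_is_zmod_morphism.
HB.instance Definition _ := GRing.isZmodMorphism.Build H R (@qb R) qb_is_zmod_morphism.
HB.instance Definition _ := GRing.isZmodMorphism.Build H R (@qc R) qc_is_zmod_morphism.
HB.instance Definition _ := GRing.isZmodMorphism.Build H R (@qd R) qd_is_zmod_morphism.

Lemma qconj_is_zmod_morphism : zmod_morphism (@qconj R).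
Proof.
by case=> ? ? ? ? [? ? ? ?]; apply: quat_eqP => //=; rewrite opprD.
Qed.
HB.instance Definition _ := GRing.isZmodMorphism.Build H H (@qconj R) qconj_is_zmod_morphism.

Lemma qreal_is_zmod_morphism : zmod_morphism (@qreal R).
Proof. by move=> r s; apply: quat_eqP => //=; rewrite subr0. Qed.
HB.instance Definition _ := GRing.isZmodMorphism.Build R H (@qreal R) qreal_is_zmod_morphism.
Lemma qreal_is_monoid_morphism : monoid_morphism (@qreal R).
Proof. by split=> // r s; apply: quat_eqP => /=; ring. Qed.
HB.instance Definition _ := GRing.isMonoidMorphism.Build R H (@qreal R) qreal_is_monoid_morphism.

Lemma qcplx_is_zmod_morphism : zmod_morphism (@qcplx R).
Proof. by case=> a b [c d]; apply: quat_eqP => //=; rewrite subr0. Qed.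
HB.instance Definition _ := GRing.isZmodMorphism.Build R[i] H (@qcplx R) qcplx_is_zmod_morphism.
Lemma qcplx_is_monoid_morphism : monoid_morphism (@qcplx R).
Proof. by split=> // -[a b] [c d]; apply: quat_eqP => /=; ring. Qed.
HB.instance Definition _ := GRing.isMonoidMorphism.Build R[i] H (@qcplx R) qcplx_is_monoid_morphism.

Lemma qconjK : involutive (@qconj R).
Proof. by case=> ? ? ? ?; apply: quat_eqP => //=; rewrite opprK. Qed.
Lemma qconjM x y : qconj (x * y) = qconj y * qconj x.
Proof. by case: x => ? ? ? ?; case: y => ? ? ? ?; apply: quat_eqP => /=; ring. Qed.
Lemma qconj1 : qconj (1 : H) = 1.
Proof. by apply: quat_eqP => //=; rewrite oppr0. Qed.
Lemma qconj_real r : qconj (qreal r) = qreal r.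
Proof. by apply: quat_eqP => //=; rewrite oppr0. Qed.
Lemma qconj_cplx (z : R[i]) : qconj (qcplx z) = qcplx (conjc z).
Proof. by case: z => a b; apply: quat_eqP => //=; rewrite oppr0. Qed.
Lemma qa_conj x : qa (qconj x) = qa x. Proof. by []. Qed.
Lemma qconj_imag x : qa x = 0 -> qconj x = - x.
Proof. by case: x => ? ? ? ? /= ->; apply: quat_eqP => //=; rewrite oppr0. Qed.
Lemma qadd_conj x : x + qconj x = qreal (qa x + qa x).
Proof. by case: x => ? ? ? ?; apply: quat_eqP => //=; rewrite subrr. Qed.
Lemma qrealC r x : qreal r * x = x * qreal r.
Proof. by case: x => ? ? ? ?; apply: quat_eqP => /=; ring. Qed.
Lemma qa_real r : qa (qreal r) = r. Proof. by []. Qed.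
Lemma qreal_inj : injective (@qreal R).
Proof. by move=> r s [->]. Qed.
Lemma qcplx_inj : injective (@qcplx R).
Proof. by move=> [a b] [c d] [-> ->]. Qed.
Lemma qaMC x y : qa (x * y) = qa (y * x).
Proof. by case: x => ? ? ? ?; case: y => ? ? ? ? /=; ring. Qed.
Lemma qa_realM r x : qa (qreal r * x) = r * qa x.
Proof. by case: x => ? ? ? ? /=; ring. Qed.

Lemma qb_realM r x : qb (qreal r * x) = r * qb x.
Proof. by case: x => ? ? ? ? /=; ring. Qed.
Lemma qc_realM r x : qc (qreal r * x) = r * qc x.
Proof. by case: x => ? ? ? ? /=; ring. Qed.
Lemma qd_realM r x : qd (qreal r * x) = r * qd x.
Proof. by case: x => ? ? ? ? /=; ring. Qed.

Lemma mul_qconj x : x * qconj x = qreal (qnorm2 x).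
Proof. by case: x => ? ? ? ?; apply: quat_eqP => /=; rewrite /qnorm2 /=; ring. Qed.
Lemma qconj_mul x : qconj x * x = qreal (qnorm2 x).
Proof. by case: x => ? ? ? ?; apply: quat_eqP => /=; rewrite /qnorm2 /=; ring. Qed.
Lemma qnorm2M x y : qnorm2 (x * y) = qnorm2 x * qnorm2 y.
Proof. by case: x => ? ? ? ?; case: y => ? ? ? ?; rewrite /qnorm2 /=; ring. Qed.
Lemma qnorm2_conj x : qnorm2 (qconj x) = qnorm2 x.
Proof. by rewrite /qnorm2 /= !sqrrN. Qed.
Lemma qnorm2N x : qnorm2 (- x) = qnorm2 x.
Proof. by rewrite /qnorm2 /= !sqrrN. Qed.
Lemma qnorm2_1 : qnorm2 (1 : H) = 1.
Proof. by rewrite /qnorm2 /=; ring. Qed.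
Lemma qnorm2_0 : qnorm2 (0 : H) = 0.
Proof. by rewrite /qnorm2 /=; ring. Qed.
Lemma qnorm2_real r : qnorm2 (qreal r) = r ^+ 2.
Proof. by rewrite /qnorm2 /=; ring. Qed.
Lemma qnorm2X x k : qnorm2 (x ^+ k) = qnorm2 x ^+ k.
Proof. by elim: k => [|k IH]; rewrite ?expr0 ?qnorm2_1 // !exprS qnorm2M IH. Qed.
Lemma qnorm2_ge0 x : 0 <= qnorm2 x.
Proof. by rewrite /qnorm2 !addr_ge0 ?sqr_ge0. Qed.
Lemma qnorm2_eq0 x : (qnorm2 x == 0) = (x == 0).
Proof.
apply/eqP/eqP => [|->]; last exact: qnorm2_0.
rewrite /qnorm2 => n0.
have ? := sqr_ge0 (qa x); have ? := sqr_ge0 (qb x).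
have ? := sqr_ge0 (qc x); have ? := sqr_ge0 (qd x).
by apply: quat_eqP => /=; apply/eqP; rewrite -sqrf_eq0; apply/eqP; lra.
Qed.
Lemma qnorm2_gt0 x : (0 < qnorm2 x) = (x != 0).
Proof. by rewrite lt_def qnorm2_ge0 andbT qnorm2_eq0. Qed.
Lemma qnorm2D_le x y : qnorm2 (x + y) <= 2 * (qnorm2 x + qnorm2 y).
Proof.
suff -> : 2 * (qnorm2 x + qnorm2 y) = qnorm2 (x + y) + qnorm2 (x - y).
  by rewrite lerDl qnorm2_ge0.
by case: x => ? ? ? ?; case: y => ? ? ? ?; rewrite /qnorm2 /=; ring.
Qed.
Lemma qcoord_sqr_le x : [/\ qa x ^+ 2 <= qnorm2 x, qb x ^+ 2 <= qnorm2 x,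
  qc x ^+ 2 <= qnorm2 x & qd x ^+ 2 <= qnorm2 x].
Proof.
rewrite /qnorm2; have ? := sqr_ge0 (qa x); have ? := sqr_ge0 (qb x).
by have ? := sqr_ge0 (qc x); have ? := sqr_ge0 (qd x); split; lra.
Qed.

Lemma qmulVx x : x != 0 -> qinv x * x = 1.
Proof.
rewrite -qnorm2_eq0; case: x => a b c d; rewrite /qnorm2 /= => n0.
by apply: quat_eqP; rewrite /qinv /qnorm2 /=; field.
Qed.
Lemma qmulxV x : x != 0 -> x * qinv x = 1.
Proof.
rewrite -qnorm2_eq0; case: x => a b c d; rewrite /qnorm2 /= => n0.
by apply: quat_eqP; rewrite /qinv /qnorm2 /=; field.
Qed.
Lemma qmul_eq0 x y : (x * y == 0) = (x == 0) || (y == 0).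
Proof. by rewrite -!qnorm2_eq0 qnorm2M mulf_eq0. Qed.

(** Multiplication by an imaginary unit moves a coordinate into the real part. Through this
    criterion the hypothesis on traces becomes a statement about real parts, hence about [rtr]. *)
Lemma is_qrealP x : is_qreal x <-> forall q, qa q = 0 -> qa (q * x) = 0.
Proof.
split=> [-> q q0|h]; first by rewrite -qrealC qa_realM q0 mulr0.
have := h (Quat 0 1 0 0) erefl; have := h (Quat 0 0 1 0) erefl.
have := h (Quat 0 0 0 1) erefl; case: x {h} => a b c d /= h1 h2 h3.
by apply: quat_eqP => //=; lra.
Qed.

Lemma qanticommP v x : qa v = 0 -> qa x = 0 -> qa (x * v) = 0 -> x * v = - (v * x).
Proof.
by case: v => ? ? ? ?; case: x => ? ? ? ? /= -> -> e; apply: quat_eqP => /=; try lra.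
Qed.
Lemma qanticomm_qa v x : v != 0 -> x * v = - (v * x) -> qa x = 0.
Proof.
move=> v0 xv.
have e1 : qa (qconj v * (x * v)) = qnorm2 v * qa x.
  by rewrite qaMC -mulrA mul_qconj -qrealC qa_realM.
have e2 : qa (qconj v * (v * x)) = qnorm2 v * qa x.
  by rewrite mulrA qconj_mul qa_realM.
move: e1; rewrite xv mulrN raddfN /= e2 => e1.
have : qnorm2 v * qa x = 0 by lra.
by move/eqP; rewrite mulf_eq0 qnorm2_eq0 (negPf v0) => /eqP.
Qed.
Lemma qcomm_anticomm_eq0 v x : v != 0 -> x * v = v * x -> x * v = - (v * x) -> x = 0.
Proof.
move=> v0 -> /eqP; rewrite -addr_eq0.
have -> : v * x + v * x = qreal 2 * (v * x).
  by case: (v * x) => ? ? ? ?; apply: quat_eqP => /=; ring.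
rewrite !qmul_eq0 (negPf v0) /= -qnorm2_eq0 qnorm2_real sqrf_eq0 pnatr_eq0 /=.
by move/eqP.
Qed.

(* If u and v are anticommuting, 1, v, u, vu is an orthogonal basis. *)
Lemma qcomm_orthoP u v x : v != 0 -> u != 0 -> qa v = 0 -> u * v = - (v * u) ->
  qa (x * u) = 0 -> qa (x * v * u) = 0 -> x * v = v * x.
Proof.
move=> v0 u0 av uv xu xvu.
(* The commutator [d] anticommutes with [v], so [d * u] commutes with [v]; the two orthogonality
   hypotheses make it anticommute as well, hence [d * u = 0]. *)
pose d := x * v - v * x.
have vv : v * v = qreal (- qnorm2 v).
  rewrite raddfN /= -mul_qconj -mulrN; congr (_ * _).
  by apply: quat_eqP => /=; rewrite ?opprK ?av ?oppr0.
have dv : d * v = - (v * d).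
  by rewrite /d mulrBl mulrBr opprB -(mulrA x) vv !mulrA vv qrealC.
have du0 : d * u = 0.
  apply: (@qcomm_anticomm_eq0 v) => //.
    by rewrite -mulrA uv mulrN !mulrA dv mulNr opprK.
  have e1 : qa (v * x * u) = - qa (x * v * u).
    by rewrite -mulrA qaMC -mulrA uv mulrN mulrA raddfN.
  have e2 : qa (x * v * u * v) = 0.
    by rewrite -mulrA uv mulrN mulrA -(mulrA x) vv -qrealC -mulrA raddfN /= qa_realM xu mulr0 oppr0.
  have e3 : qa (v * x * u * v) = 0.
    by rewrite qaMC !mulrA vv -mulrA qa_realM xu mulr0.
  apply: qanticommP => //; rewrite /d !mulrBl raddfB /=; first by rewrite e1 xvu; ring.
  by rewrite e2 e3 subr0.
have : d == 0 by move/eqP: du0; rewrite qmul_eq0 (negPf u0) orbF.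
by rewrite subr_eq0 => /eqP.
Qed.

End Quaternions.

(** * Quaternionic matrices and the Hermitian form of signature (n, 1) *)

Arguments qmul {R} x y : simpl never.
Arguments qadd {R} x y : simpl never.
Arguments qopp {R} x : simpl never.
Arguments qconj {R} q : simpl never.
Arguments qa {R} q : simpl never.

Section QuaternionicMatrices.
Variable R : realType.
Local Notation H := (quat R).

Lemma qadjK m n (A : 'M[H]_(m, n)) : qadj (qadj A) = A.
Proof. by apply/matrixP => i j; rewrite !mxE qconjK. Qed.
Lemma qadjM m n p (A : 'M[H]_(m, n)) (B : 'M[H]_(n, p)) :
  qadj (A *m B) = qadj B *m qadj A.
Proof.
apply/matrixP => i j; rewrite !mxE raddf_sum; apply: eq_bigr => k _.
by rewrite !mxE /= qconjM.
Qed.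
Lemma qadj_is_zmod_morphism m n : zmod_morphism (@qadj R m n).
Proof. by move=> A B; apply/matrixP => i j; rewrite !mxE raddfB. Qed.
HB.instance Definition _ m n :=
  GRing.isZmodMorphism.Build 'M[H]_(m, n) 'M[H]_(n, m) (@qadj R m n) (@qadj_is_zmod_morphism m n).
Lemma qadj_scalar n (a : H) : qadj (a%:M : 'M_n) = (qconj a)%:M.
Proof.
by apply/matrixP => i j; rewrite !mxE eq_sym; case: eqP; rewrite ?raddf0.
Qed.
Lemma qadj_row_mx m n1 n2 (A : 'M[H]_(m, n1)) (B : 'M[H]_(m, n2)) :
  qadj (row_mx A B) = col_mx (qadj A) (qadj B).
Proof. by apply/matrixP => i j; rewrite !mxE; case: splitP => k _; rewrite !mxE. Qed.
Lemma qadj_col_mx m1 m2 n (A : 'M[H]_(m1, n)) (B : 'M[H]_(m2, n)) :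
  qadj (col_mx A B) = row_mx (qadj A) (qadj B).
Proof. by rewrite -[RHS]qadjK qadj_row_mx !qadjK. Qed.
Lemma qadj_block_mx m1 m2 n1 n2 (A : 'M[H]_(m1, n1)) (B : 'M[H]_(m1, n2))
    (C : 'M[H]_(m2, n1)) (D : 'M[H]_(m2, n2)) :
  qadj (block_mx A B C D) = block_mx (qadj A) (qadj C) (qadj B) (qadj D).
Proof. by rewrite {1}/block_mx qadj_col_mx !qadj_row_mx -block_mxEh. Qed.
Lemma qadj_castmx m n m' n' (e : (m = m') * (n = n')) (A : 'M[H]_(m, n)) :
  qadj (castmx e A) = castmx (e.2, e.1) (qadj A).
Proof. by case: e => e1 e2; case: m' / e1; case: n' / e2; rewrite !castmx_id. Qed.

Lemma qadj_Jq n : qadj (Jq R n) = Jq R n.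
Proof.
apply/matrixP => i j; rewrite !mxE eq_sym; case: eqP => [->|_]; last exact: raddf0.
by case: ifP; rewrite ?raddfN /= qconj1.
Qed.
Lemma mul_JqE n p (A : 'M[H]_(n.+1, p)) i j :
  (Jq R n *m A) i j = (if i == ord_max then -1 else 1) * A i j.
Proof.
rewrite mxE (bigD1 i) //= big1 ?addr0 ?mxE ?eqxx // => k ki.
by rewrite mxE eq_sym (negPf ki) mul0r.
Qed.
Lemma Jq_mul n p (A : 'M[H]_(p, n.+1)) i j :
  (A *m Jq R n) i j = A i j * (if j == ord_max then -1 else 1).
Proof.
rewrite mxE (bigD1 j) //= big1 ?addr0 ?mxE ?eqxx // => k kj.
by rewrite mxE (negPf kj) mulr0.
Qed.
Lemma JqK n : Jq R n *m Jq R n = 1%:M.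
Proof.
apply/matrixP => i j; rewrite mul_JqE !mxE.
have [_|_] := eqVneq i j; last by rewrite mulr0.
by case: ifP; rewrite ?mulrNN mulr1.
Qed.

(* Unlike the H-valued trace, its real part is cyclic. *)
Definition rtr n (A : 'M[H]_n) : R := qa (\tr A).

Lemma rtr_is_zmod_morphism n : zmod_morphism (@rtr n).
Proof. by move=> A B; rewrite /rtr !raddfB. Qed.
HB.instance Definition _ n :=
  GRing.isZmodMorphism.Build 'M[H]_n R (@rtr n) (@rtr_is_zmod_morphism n).
Lemma rtr_mulC m n (A : 'M[H]_(m, n)) (B : 'M[H]_(n, m)) :
  rtr (A *m B) = rtr (B *m A).
Proof.
rewrite /rtr /mxtrace !raddf_sum /=.
under eq_bigr do rewrite mxE raddf_sum.
rewrite exchange_big; apply: eq_bigr => i _.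
by rewrite mxE raddf_sum; apply: eq_bigr => j _; rewrite /= qaMC.
Qed.
Lemma rtr_adj n (A : 'M[H]_n) : rtr (qadj A) = rtr A.
Proof.
by rewrite /rtr /mxtrace !raddf_sum; apply: eq_bigr => i _; rewrite mxE.
Qed.
Lemma rtr_qreal n r (A : 'M[H]_n) : rtr (qreal r *: A) = r * rtr A.
Proof. by rewrite /rtr mxtraceZ qa_realM. Qed.
Lemma rtr1 n : rtr (1%:M : 'M[H]_n) = n%:R.
Proof.
by rewrite /rtr mxtrace1; elim: n => // n IH; rewrite -!natr1 raddfD /= IH.
Qed.

(** Vectors form a right module over H, while [*:] scales on the left. Written as a product with a
    scalar matrix, the right action commutes with matrices by associativity. *)
Definition vs m n (v : 'M[H]_(m, n)) (a : H) := v *m a%:M.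

Lemma vsE m (v : 'cV[H]_m) a i j : vs v a i j = v i j * a.
Proof. by rewrite mxE big_ord1 !ord1 mxE eqxx mulr1n. Qed.
Lemma vsM m n (v : 'M[H]_(m, n)) a b : vs (vs v a) b = vs v (a * b).
Proof. by rewrite /vs -mulmxA -scalar_mxM. Qed.
Lemma vs1 m n (v : 'M[H]_(m, n)) : vs v 1 = v. Proof. exact: mulmx1. Qed.
Lemma vs0 m n (v : 'M[H]_(m, n)) : vs v 0 = 0.
Proof. by rewrite /vs raddf0 mulmx0. Qed.
Lemma vs0l m n a : vs (0 : 'M[H]_(m, n)) a = 0. Proof. exact: mul0mx. Qed.
Lemma vsDr m n (v : 'M[H]_(m, n)) a b : vs v (a + b) = vs v a + vs v b.
Proof. by rewrite /vs raddfD mulmxDr. Qed.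
Lemma vsDl m n (v w : 'M[H]_(m, n)) a : vs (v + w) a = vs v a + vs w a.
Proof. by rewrite /vs mulmxDl. Qed.
Lemma vsNr m n (v : 'M[H]_(m, n)) a : vs v (- a) = - vs v a.
Proof. by rewrite /vs raddfN mulmxN. Qed.
Lemma vsNl m n (v : 'M[H]_(m, n)) a : vs (- v) a = - vs v a.
Proof. exact: mulNmx. Qed.
Lemma vs_mul m n p (A : 'M[H]_(m, n)) (v : 'M[H]_(n, p)) a :
  A *m vs v a = vs (A *m v) a.
Proof. exact: mulmxA. Qed.
Lemma vs_scale m n q (v : 'M[H]_(m, n)) a : q *: vs v a = vs (q *: v) a.
Proof. exact: scalemxAl. Qed.
Lemma vs_real m n r (v : 'M[H]_(m, n)) : vs v (qreal r) = qreal r *: v.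
Proof.
apply/matrixP => i j; rewrite mxE (bigD1 j) //= big1 => [|k kj]; last first.
  by rewrite mxE (negPf kj) mulr0.
by rewrite !mxE eqxx mulr1n addr0 qrealC.
Qed.
Lemma vs_eq0 m (v : 'cV[H]_m) a : vs v a = 0 -> (v == 0) || (a == 0).
Proof.
move=> va; case: eqP => //= v0; apply/negPn/negP => a0; apply: v0.
by rewrite -(vs1 v) -(qmulxV a0) -vsM va vs0l.
Qed.
Lemma scale_real m n p r (A : 'M[H]_(m, n)) (B : 'M[H]_(n, p)) :
  A *m (qreal r *: B) = qreal r *: (A *m B).
Proof. by rewrite -!vs_real vs_mul. Qed.
Lemma qadj_real m n r (A : 'M[H]_(m, n)) : qadj (qreal r *: A) = qreal r *: qadj A.
Proof. by apply/matrixP => i j; rewrite !mxE qconjM qconj_real qrealC. Qed.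

End QuaternionicMatrices.

Section Form.
Variables (R : realType) (n : nat).
Local Notation H := (quat R).
Local Notation V := 'cV[quat R]_n.+1.
Local Notation J := (Jq R n).

Lemma sp_invM (A B : 'M[H]_n.+1) : sp_inv (A *m B) = sp_inv B *m sp_inv A.
Proof. by rewrite /sp_inv qadjM -!mulmxA (mulmxA J J) JqK mul1mx. Qed.
Lemma sp_invK (A : 'M[H]_n.+1) : sp_inv (sp_inv A) = A.
Proof.
rewrite /sp_inv !qadjM qadjK qadj_Jq -!mulmxA JqK mulmx1 mulmxA JqK.
by rewrite mul1mx.
Qed.
Lemma sp_inv_real r (A : 'M[H]_n.+1) : sp_inv (qreal r *: A) = qreal r *: sp_inv A.
Proof. by rewrite /sp_inv qadj_real scale_real -scalemxAl. Qed.

Lemma in_Sp_mulV (A : 'M[H]_n.+1) : in_Sp_n1 A <-> sp_inv A *m A = 1%:M.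
Proof.
rewrite /in_Sp_n1 /sp_inv -!mulmxA; split=> [->|h]; first exact: JqK.
by rewrite -[LHS]mul1mx -JqK -!mulmxA h mulmx1.
Qed.
Lemma in_Sp_mulmxV (A : 'M[H]_n.+1) : in_Sp_n1 (sp_inv A) <-> A *m sp_inv A = 1%:M.
Proof. by rewrite in_Sp_mulV sp_invK. Qed.

Lemma in_Sp_n1M (A B : 'M[H]_n.+1) : in_Sp_n1 A -> in_Sp_n1 B -> in_Sp_n1 (A *m B).
Proof.
move=> /in_Sp_mulV hA /in_Sp_mulV hB; apply/in_Sp_mulV.
by rewrite sp_invM -mulmxA (mulmxA _ A) hA mul1mx.
Qed.

Definition hf (v w : V) : H := (qadj v *m J *m w) 0 0.

Lemma hfE v w : hf v w = \sum_(i < n) qconj (v (widen_ord (leqnSn n) i) 0) * w (widen_ord (leqnSn n) i) 0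
                          - qconj (v ord_max 0) * w ord_max 0.
Proof.
rewrite /hf mxE big_ord_recr /= Jq_mul eqxx mxE mulrN1 mulNr; congr (_ - _).
apply: eq_bigr => i _; rewrite Jq_mul mxE ifN ?mulr1 //.
by rewrite -val_eqE /= neq_ltn ltn_ord.
Qed.
Lemma hfM v w : qadj v *m J *m w = (hf v w)%:M.
Proof. exact: mx11_scalar. Qed.
Lemma hfC v w : hf v w = qconj (hf w v).
Proof.
have := congr1 (fun A => qadj A 0 0) (hfM w v).
by rewrite /= !qadjM qadjK qadj_Jq mulmxA hfM qadj_scalar !mxE eqxx !mulr1n.
Qed.
Lemma hfDr v w1 w2 : hf v (w1 + w2) = hf v w1 + hf v w2.
Proof. by rewrite /hf mulmxDr mxE. Qed.
Lemma hfDl v1 v2 w : hf (v1 + v2) w = hf v1 w + hf v2 w.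
Proof. by rewrite /hf raddfD !mulmxDl mxE. Qed.
Lemma hfNr v w : hf v (- w) = - hf v w.
Proof. by rewrite /hf mulmxN mxE. Qed.
Lemma hfNl v w : hf (- v) w = - hf v w.
Proof. by rewrite /hf raddfN !mulNmx mxE. Qed.
Lemma hf0r v : hf v 0 = 0. Proof. by rewrite /hf mulmx0 mxE. Qed.
Lemma hf_vsr v w a : hf v (vs w a) = hf v w * a.
Proof. by rewrite /hf vs_mul vsE. Qed.
Lemma hf_vsl v w a : hf (vs v a) w = qconj a * hf v w.
Proof. by rewrite hfC hf_vsr qconjM -hfC. Qed.
Lemma hf_mul A v w : hf (A *m v) w = hf v (sp_inv A *m w).
Proof.
by rewrite /hf /sp_inv qadjM !mulmxA -(mulmxA (qadj v) J J) JqK mulmx1.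
Qed.
Lemma hf_Sp A v w : in_Sp_n1 A -> hf (A *m v) (A *m w) = hf v w.
Proof. by move/in_Sp_mulV => h; rewrite hf_mul mulmxA h mul1mx. Qed.
Lemma hf_scale q v w : hf (q *: v) w = hf v (qconj q *: w).
Proof.
rewrite -!mul_scalar_mx hf_mul /sp_inv qadj_scalar; congr (hf v (_ *m w)).
apply/matrixP => i j; rewrite Jq_mul mul_JqE !mxE; have [->|_] := eqVneq i j.
  by rewrite mulr1n; case: ifP; rewrite ?mulN1r ?mulrN1 ?opprK ?mul1r ?mulr1.
by rewrite mulr0n mulr0 mul0r.
Qed.

Definition ro (v w : V) : 'M[H]_n.+1 := v *m qadj w *m J.

Lemma ro_mulv v w z : ro v w *m z = vs v (hf w z).
Proof. by rewrite /ro /vs -hfM !mulmxA. Qed.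
Lemma mul_ro A v w : A *m ro v w = ro (A *m v) w.
Proof. by rewrite /ro !mulmxA. Qed.
Lemma ro_mul A v w : ro v w *m A = ro v (sp_inv A *m w).
Proof.
by rewrite /ro /sp_inv !qadjM qadjK qadj_Jq -!mulmxA JqK mulmx1.
Qed.
Lemma ro_vs v w a : ro v (vs w a) = ro (vs v (qconj a)) w.
Proof. by rewrite /ro /vs qadjM qadj_scalar !mulmxA. Qed.
Lemma ro_ro v w v' w' : ro v w *m ro v' w' = ro (vs v (hf w v')) w'.
Proof. by rewrite mul_ro ro_mulv. Qed.
Lemma sp_inv_ro v w : sp_inv (ro v w) = ro w v.
Proof. by rewrite /sp_inv /ro !qadjM qadjK qadj_Jq !mulmxA JqK mul1mx. Qed.
(** Cyclicity of the real trace collapses the operator to a scalar; this is the bridge from traces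
    to values of the form. *)
Lemma rtr_ro q v w : rtr (q%:M *m ro v w) = qa (hf w (q *: v)).
Proof.
rewrite mul_ro mul_scalar_mx /ro -mulmxA rtr_mulC /rtr hfM.
by rewrite /mxtrace big_ord1 mxE eqxx.
Qed.
Lemma roDl v1 v2 w : ro (v1 + v2) w = ro v1 w + ro v2 w.
Proof. by rewrite /ro !mulmxDl. Qed.
Lemma ro_real v w r : ro (qreal r *: v) w = qreal r *: ro v w.
Proof. by rewrite /ro -!scalemxAl. Qed.

Lemma hf_diag_real v : hf v v = qreal (qa (hf v v)).
Proof.
have := hfC v v; case: (hf v v) => a b c d [h1 h2 h3].
by apply: quat_eqP => //=; lra.
Qed.
Lemma hf_eq0C v w : hf v w = 0 -> hf w v = 0.
Proof. by move=> h; rewrite hfC h raddf0. Qed.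

Lemma lift_max_widen k (i : 'I_k) : lift ord_max i = widen_ord (leqnSn k) i.
Proof. by apply: val_inj; rewrite /= /bump leqNgt ltn_ord. Qed.

(** The source of the facts on orthogonal complements below: subtracting a multiple of a vector with
    nonzero last coordinate brings any vector into this hyperplane. *)
Lemma hf_last0 (v : V) : v ord_max 0 = 0 ->
  0 <= qa (hf v v) /\ (qa (hf v v) = 0 -> v = 0).
Proof.
move=> v0; have -> : qa (hf v v) = \sum_(i < n) qnorm2 (v (widen_ord (leqnSn n) i) 0).
  rewrite hfE v0 mulr0 subr0 raddf_sum /=.
  by apply: eq_bigr => i _; rewrite qconj_mul.
split=> [|s0]; first by apply: sumr_ge0 => i _; exact: qnorm2_ge0.
apply/matrixP => i j; rewrite ord1 [RHS]mxE.
case: (unliftP ord_max i) => [k ->|-> //]; rewrite lift_max_widen.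
move/eqP: s0; rewrite psumr_eq0 => [/allP/(_ k (mem_index_enum _))|? _]; last exact: qnorm2_ge0.
by rewrite qnorm2_eq0 => /eqP.
Qed.

Lemma hf_neg_last (w : V) : qa (hf w w) < 0 -> w ord_max 0 != 0.
Proof. by apply: contraTneq => /hf_last0 [h _]; rewrite -leNgt. Qed.
Lemma hf_null_last (w : V) : hf w w = 0 -> w != 0 -> w ord_max 0 != 0.
Proof. by move=> w0; apply: contra_neq => /hf_last0 [_]; apply; rewrite w0. Qed.

Lemma clear_last (w z : V) : w ord_max 0 != 0 ->
  exists c, (z - vs w c) ord_max 0 = 0.
Proof.
move=> w0; exists (qinv (w ord_max 0) * z ord_max 0).
by rewrite mxE [(- _ : V) _ _]mxE vsE mulrA qmulxV // mul1r subrr.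
Qed.

Lemma hf_sub_vs w z c : hf w z = 0 ->
  qa (hf (z - vs w c) (z - vs w c)) = qa (hf z z) + qa (hf w w) * qnorm2 c.
Proof.
move=> wz; have zw := hf_eq0C wz.
rewrite !(hfDl, hfDr, hfNl, hfNr, hf_vsl, hf_vsr) wz zw !(mul0r, mulr0, subr0, sub0r, oppr0, opprK).
rewrite raddfD /=; congr (_ + _).
by rewrite mulrN opprK {1}(hf_diag_real w) qrealC mulrA qconj_mul qa_realM mulrC.
Qed.

(** Clearing the last coordinate of [z] with a multiple of [w] adds [qa (hf w w) * qnorm2 c <= 0] to
    the form, and the result is still nonnegative by [hf_last0]. *)
Lemma hf_neg_ortho w z : qa (hf w w) < 0 -> hf w z = 0 ->
  0 <= qa (hf z z) /\ (qa (hf z z) = 0 -> z = 0).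
Proof.
move=> wn wz; have [c zc] := clear_last z (hf_neg_last wn).
have [p p0] := hf_last0 zc; rewrite hf_sub_vs // in p p0.
have c0 := qnorm2_ge0 c; split=> [|z0]; first by nra.
rewrite z0 add0r in p p0.
have {}c0 : c == 0 by rewrite -qnorm2_eq0; apply/eqP; nra.
move: p0; rewrite (eqP c0) qnorm2_0 mulr0 vs0 subr0; exact.
Qed.

(** Clearing the last coordinate of [y] with [x] keeps the form at 0, and a null vector in a
    positive definite hyperplane is zero. *)
Lemma hf_null_ortho x y : x != 0 -> hf x x = 0 -> hf y y = 0 -> hf x y = 0 ->
  exists a, y = vs x a.
Proof.
move=> x0 xx yy xy; have [c zc] := clear_last y (hf_null_last xx x0).
have [_ h] := hf_last0 zc; rewrite hf_sub_vs // xx yy mul0r addr0 in h.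
by exists c; apply/eqP; rewrite -subr_eq0; apply/eqP/h.
Qed.

(** An explicit negative vector in the plane of two nonorthogonal null vectors, which makes
    [hf_neg_ortho] apply to the complement of that plane. *)
Lemma hf_plane_neg x x' : hf x x = 0 -> hf x' x' = 0 ->
  hf (x - vs x' (hf x' x)) (x - vs x' (hf x' x)) = qreal (-2 * qnorm2 (hf x x')).
Proof.
move=> xx xx'; rewrite !(hfDl, hfDr, hfNl, hfNr, hf_vsl, hf_vsr) xx xx'.
rewrite -(hfC x x') !(mul0r, mulr0) (hfC x' x) mul_qconj.
by rewrite oppr0 mulr0 subr0 sub0r -raddfN -raddfD /=; congr qreal; ring.
Qed.

Lemma hf_plane_ortho x x' z : hf x x = 0 -> hf x' x' = 0 -> hf x x' != 0 ->
  hf x z = 0 -> hf x' z = 0 -> 0 <= qa (hf z z) /\ (qa (hf z z) = 0 -> z = 0).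
Proof.
move=> xx xx' k0 xz xz'; apply: (@hf_neg_ortho (x - vs x' (hf x' x))).
  by rewrite hf_plane_neg // qa_real; rewrite -qnorm2_gt0 in k0; nra.
by rewrite hfDl hfNl hf_vsl xz xz' mulr0 subr0.
Qed.

End Form.

(** * Real-linear maps and completion of orthonormal families *)

Section RealLinear.
Variable R : realType.
Local Notation H := (quat R).

Section InjSurj.
Variable m : nat.
Local Notation U := ('cV[R]_m * 'cV[R]_m * 'cV[R]_m * 'cV[R]_m)%type.
Local Notation W := 'cV[quat R]_m.

Let enc (v : W) : U :=
  (map_mx (@qa R) v, map_mx (@qb R) v, map_mx (@qc R) v, map_mx (@qd R) v).
Let dec (t : U) : W :=
  \col_i Quat (t.1.1.1 i 0) (t.1.1.2 i 0) (t.1.2 i 0) (t.2 i 0).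

Let encK : cancel enc dec.
Proof. by move=> v; apply/matrixP => i j; rewrite !mxE ord1; case: (v i 0). Qed.
Let decK : cancel dec enc.
Proof.
move=> [[[a b] c] d]; congr (_, _, _, _); apply/matrixP => i j;
by rewrite !mxE ord1.
Qed.
Let enc_lin a u v : enc (qreal a *: u + v) = a *: enc u + enc v.
Proof.
by rewrite /enc; congr (_, _, _, _); apply/matrixP => i j; rewrite !mxE
  raddfD /= (qa_realM, qb_realM, qc_realM, qd_realM).
Qed.

(** The four coordinate columns identify H^m with R^(4m), where dimensions can be counted. Linearity
    over R suffices, so that the lemma also serves [v |-> h v - v t], which is not linear over H. *)
Lemma rlinear_inj_surj (f : W -> W) :
  (forall u v, f (u + v) = f u + f v) ->
  (forall r u, f (qreal r *: u) = qreal r *: f u) ->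
  (forall u, f u = 0 -> u = 0) -> forall w, exists u, f u = w.
Proof.
move=> fD fZ f0 w.
pose g t := enc (f (dec t)).
have gl : linear g.
  move=> a u v; rewrite /g -enc_lin -fZ -fD; congr (enc (f _)).
  by apply: (can_inj encK); rewrite decK enc_lin !decK.
pose gL : {linear U -> U} := HB.pack g (GRing.isLinear.Build _ _ _ _ g gl).
have fN v : f (- v) = - f v.
  have -> : - v = qreal (-1) *: v by rewrite raddfN /= scaleN1r.
  by rewrite fZ raddfN /= scaleN1r.
have inj : lker (linfun gL) == 0%VS.
  apply/lker0P => s t; rewrite !lfunE /= => /(can_inj encK) /eqP.
  rewrite -subr_eq0 -fN -fD => /eqP /f0 /eqP.
  by rewrite subr_eq0 => /eqP /(can_inj decK).
have : enc w \in limg (linfun gL) by rewrite lker0_limgf ?memvf.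
case/memv_imgP => t _; rewrite lfunE /= => /(can_inj encK) ->.
by exists (dec t).
Qed.

End InjSurj.

Lemma mulmx_id_eq1 N (A : 'M[H]_N) : (forall w : 'cV_N, A *m w = w) -> A = 1%:M.
Proof.
move=> h; apply/matrixP => i j; have := congr1 (fun M : 'cV[H]_(_) => M i 0) (h (delta_mx j 0)).
by rewrite -colE !mxE eqxx andbT.
Qed.

Lemma qmulmx1C N (A B : 'M[H]_N) : A *m B = 1%:M -> B *m A = 1%:M.
Proof.
move=> AB; apply: mulmx_id_eq1 => w.
have [] := @rlinear_inj_surj N (mulmx B) (fun u v => mulmxDr B u v)
  (fun r u => scale_real r B u) _ w.
  by move=> u Bu; rewrite -(mul1mx u) -AB -mulmxA Bu mulmx0.
by move=> u <-; rewrite -mulmxA (mulmxA A) AB mul1mx.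
Qed.

(** If [r] exceeded [N], padding [F] with zero rows would give an injective map of H^r into itself
    that misses the basis vector of index [N]. *)
Lemma left_inverse_leq N r (F : 'M[H]_(N, r)) (L : 'M[H]_(r, N)) :
  L *m F = 1%:M -> (r <= N)%N.
Proof.
move=> LF; rewrite leqNgt; apply/negP => Nr.
pose f (c : 'cV[H]_r) : 'cV[H]_r :=
  \col_i (if insub (val i) is Some j then (F *m c) j 0 else 0).
have [] := @rlinear_inj_surj r f _ _ _ (delta_mx (Ordinal Nr) 0).
- move=> u v; apply/matrixP => i j; rewrite !mxE.
  by case: insubP => *; rewrite ?addr0 // mulmxDr mxE.
- move=> a v; apply/matrixP => i j; rewrite !mxE.
  by case: insubP => *; rewrite ?mulr0 // scale_real mxE.
- move=> u fu; rewrite -[u]mul1mx -LF -mulmxA.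
  suff -> : F *m u = 0 by rewrite mulmx0.
  apply/matrixP => i j; rewrite ord1.
  have := congr1 (fun M : 'cV[H]_(_) => M (widen_ord (ltnW Nr) i) 0) fu.
  rewrite mxE; case: insubP => [i' _ ii'|]; last by rewrite /= ltn_ord.
  have -> : i' = i by apply: val_inj.
  by rewrite !mxE.
- move=> u /(congr1 (fun M : 'cV[H]_(_) => M (Ordinal Nr) 0)); rewrite !mxE /= insubF ?ltnn // !eqxx /=.
  by move/eqP; rewrite eq_sym oner_eq0.
Qed.

End RealLinear.

Section Completion.
Variables (R : realType) (n : nat).
Local Notation H := (quat R).
Local Notation V := 'cV[quat R]_n.+1.
Local Notation J := (Jq R n).

Lemma gram_adj p q (A : 'M[H]_(n.+1, p)) (B : 'M[H]_(n.+1, q)) :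
  qadj A *m J *m B = qadj (qadj B *m J *m A).
Proof. by rewrite !qadjM qadjK qadj_Jq mulmxA. Qed.

(** [P] is the orthogonal projection onto the span of [X]. Its real trace is [r], so [P] is not the
    identity, and any nonzero column of [1 - P] is orthogonal to [X]. *)
Lemma exists_ortho r (X : 'M[H]_(n.+1, r)) (S : 'M[H]_r) :
  qadj X *m J *m X = S -> S *m S = 1%:M -> (r < n.+1)%N ->
  exists2 v : V, v != 0 & qadj X *m J *m v = 0.
Proof.
move=> XX SS rn; pose P := X *m S *m qadj X *m J.
have [/eqP P1|P1] := eqVneq (1%:M - P) 0.
  have : rtr (1%:M : 'M[H]_n.+1) = rtr (1%:M : 'M[H]_r).
    move: P1; rewrite subr_eq0 => /eqP ->.
    by rewrite /P -!mulmxA rtr_mulC -!mulmxA (mulmxA _ J) XX SS.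
  by rewrite !rtr1 => /eqP; rewrite eqr_nat => /eqP e; rewrite e ltnn in rn.
have [j vj] : exists j, col j (1%:M - P) != 0.
  apply/existsP; apply: contraNT P1 => /existsPn h; apply/eqP/matrixP => i j.
  have /negPn/eqP hj := h j.
  have := congr1 (fun M : 'cV[H]_n.+1 => M i 0) hj.
  by rewrite !mxE.
exists (col j (1%:M - P)) => //.
rewrite colE mulmxA mulmxBr mulmx1 /P !mulmxA XX SS mul1mx subrr.
by rewrite mul0mx.
Qed.

Lemma normalize_pos (v : V) : 0 < qa (hf v v) ->
  hf (qreal (Num.sqrt (qa (hf v v)))^-1 *: v) (qreal (Num.sqrt (qa (hf v v)))^-1 *: v) = 1.
Proof.
move=> v0; rewrite -vs_real hf_vsl hf_vsr qconj_real -qrealC mulrA.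
rewrite [hf v v]hf_diag_real qa_real -!rmorphM /=.
rewrite -expr2 exprVn sqr_sqrtr ?mulVf ?rmorph1 ?gt_eqF //; exact: ltW.
Qed.

(** The last column of [F] is negative, so a nonzero vector orthogonal to [E] and [F] is positive
    and can be normalized. *)
Lemma complete_basis m (F : 'M[H]_(n.+1, m.+1)) k :
  qadj F *m J *m F = Jq R m -> (k + m <= n)%N ->
  exists E : 'M[H]_(n.+1, k), qadj E *m J *m E = 1%:M /\ qadj E *m J *m F = 0.
Proof.
move=> FF; elim: k => [|k IH] kn.
  by exists 0; split; apply/matrixP => -[].
have [E [EE EF]] := IH (ltnW kn).
have FE : qadj F *m J *m E = 0.
  by rewrite gram_adj EF raddf0.
have [] := @exists_ortho _ (row_mx E F) (block_mx 1%:M 0 0 (Jq R m)).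
- by rewrite qadj_row_mx mul_col_mx mul_col_row EE EF FE FF.
- by rewrite mulmx_block !mulmx0 !mul0mx !addr0 !add0r mulmx1 JqK -scalar_mx_block.
- by rewrite addnS.
move=> v v0; rewrite qadj_row_mx !mul_col_mx => /eqP.
rewrite -col_mx0 => /eqP/eq_col_mx [Ev Fv].
pose w := col ord_max F.
have ww : hf w w = -1.
  rewrite /hf /w !colE qadjM !mulmxA -(mulmxA _ _ J) -(mulmxA _ _ F) FF.
  rewrite -mulmxA mxE (bigD1 ord_max) //= big1 => [|i im]; last first.
    by rewrite !mxE (negPf im) raddf0 mul0r.
  rewrite addr0 mul_JqE eqxx !mxE !eqxx /= qconj1 mul1r mulr1 //.
have wv : hf w v = 0.
  by rewrite /hf /w colE qadjM -!mulmxA (mulmxA _ J) Fv mulmx0 mxE.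
have [vp v00] : 0 <= qa (hf v v) /\ (qa (hf v v) = 0 -> v = 0).
  by apply: (@hf_neg_ortho _ _ w) => //; rewrite ww raddfN /= oppr_lt0 ltr01.
have {}vp : 0 < qa (hf v v).
  by rewrite lt_def vp andbT; apply: contra_neq v0.
pose v1 := qreal (Num.sqrt (qa (hf v v)))^-1 *: v.
have v11 : qadj v1 *m J *m v1 = 1%:M by rewrite hfM normalize_pos.
have Ev1 : qadj E *m J *m v1 = 0 by rewrite scale_real Ev scaler0.
have Fv1 : qadj F *m J *m v1 = 0 by rewrite scale_real Fv scaler0.
rewrite -[k.+1]/(1 + k)%N; exists (row_mx v1 E); rewrite qadj_row_mx; split.
  rewrite mul_col_mx mul_col_row v11 Ev1 EE scalar_mx_block; congr block_mx.
  by rewrite gram_adj Ev1 raddf0.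
rewrite !mul_col_mx EF -col_mx0; congr col_mx.
by rewrite gram_adj Fv1 raddf0.
Qed.

Lemma castmx_Jq k m (e : (k + m.+1 = n.+1)%N) :
  castmx (e, e) (block_mx (1%:M : 'M[H]_k) 0 0 (Jq R m)) = J.
Proof.
apply/matrixP => i j; rewrite castmxE /= !mxE.
have maxE (a : 'I_n.+1) : (a == ord_max) = (val a == k + m)%N.
  by rewrite -val_eqE /=; move: e; rewrite addnS => -[->].
rewrite maxE -val_eqE /=.
case: splitP => a /= ia; rewrite !mxE; case: splitP => b /= jb; rewrite !mxE ?ia ?jb.
- rewrite -val_eqE; case: eqP => // _; rewrite ifN //.
  by rewrite neq_ltn ltn_addr.
- by rewrite ifN // neq_ltn ltn_addr.
- by rewrite ifN // eq_sym neq_ltn ltn_addr.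
- by rewrite -!val_eqE /= !eqn_add2l.
Qed.

Lemma gram_castmx m (e : m = n.+1) (X : 'M[H]_(n.+1, m)) (g : 'M[H]_n.+1) :
  qadj (castmx (erefl _, e) X) *m g *m castmx (erefl _, e) X
  = castmx (e, e) (qadj X *m g *m X).
Proof.
by rewrite qadj_castmx /=; move: g X; case: _ / e.
Qed.

End Completion.

Local Open Scope classical_set_scope.

(** * Limits of quaternionic matrices along filters *)

Section Limits.
Variable R : realType.
Local Notation H := (quat R).

Definition qcvg (F : set_system nat) (u : nat -> H) (l : H) : Prop :=
  [/\ (fun k => qa (u k)) @ F --> qa l, (fun k => qb (u k)) @ F --> qb l,
      (fun k => qc (u k)) @ F --> qc l & (fun k => qd (u k)) @ F --> qd l].

Definition mcvg (F : set_system nat) m n (A : nat -> 'M[H]_(m, n)) (L : 'M[H]_(m, n)) : Prop :=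
  forall i j, qcvg F (fun k => A k i j) (L i j).

Section Filter.
Context (F : set_system nat) {FF : ProperFilter F}.

Lemma qcvg_cst a : qcvg F (fun=> a) a.
Proof. by split; apply: cvg_cst. Qed.
Lemma qcvgD u v a b : qcvg F u a -> qcvg F v b -> qcvg F (fun k => u k + v k) (a + b).
Proof. by move=> [? ? ? ?] [? ? ? ?]; split; exact: cvgD. Qed.
Lemma qcvgM u v a b : qcvg F u a -> qcvg F v b -> qcvg F (fun k => u k * v k) (a * b).
Proof.
have qaM x y : @qa R (x * y) = qa x * qa y - qb x * qb y - qc x * qc y - qd x * qd y.
  by case: x; case: y.
have qbM x y : @qb R (x * y) = qa x * qb y + qb x * qa y + qc x * qd y - qd x * qc y.
  by case: x; case: y.
have qcM x y : @qc R (x * y) = qa x * qc y - qb x * qd y + qc x * qa y + qd x * qb y.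
  by case: x; case: y.
have qdM x y : @qd R (x * y) = qa x * qd y + qb x * qc y - qc x * qb y + qd x * qa y.
  by case: x; case: y.
move=> [ua ub uc ud] [va vb vc vd]; split.
- by under eq_fun do rewrite qaM; rewrite qaM; repeat apply: cvgB; exact: cvgM.
- under eq_fun do rewrite qbM; rewrite qbM.
  by apply: cvgB; [repeat apply: cvgD|]; exact: cvgM.
- under eq_fun do rewrite qcM; rewrite qcM.
  by apply: cvgD; [apply: cvgD; [apply: cvgB|]|]; exact: cvgM.
- under eq_fun do rewrite qdM; rewrite qdM.
  by apply: cvgD; [apply: cvgB; [apply: cvgD|]|]; exact: cvgM.
Qed.
Lemma qcvg_conj u a : qcvg F u a -> qcvg F (fun k => qconj (u k)) (qconj a).
Proof. by move=> [? ? ? ?]; split=> //; exact: cvgN. Qed.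
Lemma qcvg_sum (I : Type) (r : seq I) (P : pred I) (u : I -> nat -> H) (a : I -> H) :
  (forall i, qcvg F (u i) (a i)) ->
  qcvg F (fun k => \sum_(i <- r | P i) u i k) (\sum_(i <- r | P i) a i).
Proof.
move=> ua; elim: r => [|i r IH].
  by under eq_fun do rewrite big_nil; rewrite big_nil; exact: qcvg_cst.
under eq_fun do rewrite big_cons; rewrite big_cons; case: (P i) => //.
exact: qcvgD.
Qed.
Lemma qcvg_qreal (r : nat -> R) (l : R) : r @ F --> l -> qcvg F (fun k => qreal (r k)) (qreal l).
Proof. by move=> rl; split=> //; exact: cvg_cst. Qed.
Lemma cvg_qnorm2 u a : qcvg F u a -> (fun k => qnorm2 (u k)) @ F --> qnorm2 a.
Proof. by move=> [? ? ? ?]; repeat apply: cvgD; exact: cvgM. Qed.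
Lemma cvg_qa u a : qcvg F u a -> (fun k => qa (u k)) @ F --> qa a.
Proof. by case. Qed.
Lemma real_cvg_uniq (r : nat -> R) (a b : R) : r @ F --> a -> r @ F --> b -> a = b.
Proof. by move=> ra rb; apply: (norm_cvg_unique ra rb). Qed.
Lemma qcvg_uniq u a b : qcvg F u a -> qcvg F u b -> a = b.
Proof.
move=> [ua ub uc ud] [va vb vc vd].
by apply: quat_eqP; [exact: real_cvg_uniq ua va|exact: real_cvg_uniq ub vb|
  exact: real_cvg_uniq uc vc|exact: real_cvg_uniq ud vd].
Qed.

Lemma mcvg_cst m n (L : 'M[H]_(m, n)) : mcvg F (fun=> L) L.
Proof. by move=> i j; exact: qcvg_cst. Qed.
Lemma mcvgM m n p A (L : 'M[H]_(m, n)) B (M : 'M[H]_(n, p)) :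
  mcvg F A L -> mcvg F B M -> mcvg F (fun k => A k *m B k) (L *m M).
Proof.
move=> AL BM i j; rewrite /mcvg mxE; under [X in qcvg _ X _]eq_fun do rewrite mxE.
by apply: qcvg_sum => l; exact: qcvgM.
Qed.
Lemma mcvg_adj m n A (L : 'M[H]_(m, n)) :
  mcvg F A L -> mcvg F (fun k => qadj (A k)) (qadj L).
Proof.
move=> AL i j; rewrite mxE; under [X in qcvg _ X _]eq_fun do rewrite mxE.
exact: qcvg_conj.
Qed.
Lemma mcvg_sp_inv n A (L : 'M[H]_n.+1) :
  mcvg F A L -> mcvg F (fun k => sp_inv (A k)) (sp_inv L).
Proof.
by move=> AL; apply: mcvgM (mcvg_cst _); apply: mcvgM (mcvg_cst _) (mcvg_adj AL).
Qed.
Lemma mcvg_scale m n a c A (L : 'M[H]_(m, n)) :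
  qcvg F a c -> mcvg F A L -> mcvg F (fun k => a k *: A k) (c *: L).
Proof.
move=> ac AL i j; rewrite mxE; under [X in qcvg _ X _]eq_fun do rewrite mxE.
exact: qcvgM.
Qed.
Lemma mcvg_uniq m n A (L M : 'M[H]_(m, n)) : mcvg F A L -> mcvg F A M -> L = M.
Proof. by move=> AL AM; apply/matrixP => i j; exact: qcvg_uniq (AL i j) (AM i j). Qed.
Lemma cvg_rtr n A (L : 'M[H]_n) : mcvg F A L -> (fun k => rtr (A k)) @ F --> rtr L.
Proof. by move=> AL; apply: cvg_qa; apply: qcvg_sum => i. Qed.
Lemma cvg_mxdist2 n A (L M : 'M[H]_n) : mcvg F A L ->
  (fun k => mxdist2 (A k) M) @ F --> mxdist2 L M.
Proof.
move=> AL.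
suff h : qcvg F (fun k => qreal (mxdist2 (A k) M)) (qreal (mxdist2 L M)) by case: h.
rewrite /mxdist2 raddf_sum /=; under [X in qcvg _ X _]eq_fun do rewrite raddf_sum /=.
apply: qcvg_sum => i; rewrite raddf_sum /=; under [X in qcvg _ X _]eq_fun do rewrite raddf_sum /=.
apply: qcvg_sum => j; apply: qcvg_qreal; apply: cvg_qnorm2.
by apply: qcvgD => //; exact: qcvg_cst.
Qed.
End Filter.

(** Such an ultrafilter replaces the extraction of subsequences: along it every bounded sequence
    converges. *)
Lemma exists_ultra : exists U : set_system nat,
  UltraFilter U /\ forall N, U [set k | (N <= k)%N].
Proof.
have [U [UU sU]] := @ultraFilterLemma nat \oo _.
by exists U; split=> // N; apply: sU; exists N.
Qed.

Lemma ultra_real_cvg U (r : nat -> R) (C : R) : UltraFilter U ->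
  (forall k, r k ^+ 2 <= C) -> exists l : R, r @ U --> l.
Proof.
move=> UU rC.
have FU : UltraFilter (r @ U).
  split=> [|G GG sG]; first exact: fmap_proper_filter.
  rewrite eqEsubset; split=> // A GA /=.
  have [//|UnA] := in_ultra_setVsetC (r @^-1` A) UU.
  have : G (A `&` ~` A) by apply: filterI => //; apply: sG.
  by rewrite setICr => /filter_not_empty.
(* [C + 1] bounds [|r k|] whenever [r k ^+ 2 <= C], without a square root. *)
have := @segment_compact R (- (C + 1)) (C + 1).
rewrite compact_ultra => /(_ _ FU) [|l [_ rl]]; last by exists l.
apply: (@filterE nat U) => k /=; rewrite in_itv /=; have := rC k => ?.
by apply/andP; split; nra.
Qed.

Lemma ultra_mcvg U m n (A : nat -> 'M[H]_(m, n)) (C : R) : UltraFilter U ->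
  (forall k i j, qnorm2 (A k i j) <= C) -> exists L, mcvg U A L.
Proof.
move=> UU AC.
have q i j : exists l : H, qcvg U (fun k => A k i j) l.
  have b k : [/\ qa (A k i j) ^+ 2 <= C, qb (A k i j) ^+ 2 <= C,
      qc (A k i j) ^+ 2 <= C & qd (A k i j) ^+ 2 <= C].
    by have [ha hb hc hd] := qcoord_sqr_le (A k i j); split; apply: le_trans (AC k i j).
  have [] := @ultra_real_cvg U (fun k => qa (A k i j)) C; [by move=> k; case: (b k)|move=> la ha].
  have [] := @ultra_real_cvg U (fun k => qb (A k i j)) C; [by move=> k; case: (b k)|move=> lb hb].
  have [] := @ultra_real_cvg U (fun k => qc (A k i j)) C; [by move=> k; case: (b k)|move=> lc hc].
  have [] := @ultra_real_cvg U (fun k => qd (A k i j)) C; [by move=> k; case: (b k)|move=> ld hd].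
  by exists (Quat la lb lc ld); split.
exists (\matrix_(i, j) projT1 (choice (q i)) j) => i j; rewrite mxE.
exact: projT2 (choice (q i)) j.
Qed.

End Limits.

(** * The real span of the group and the ball model *)

Section SpanAlgebra.
Variables (R : realType) (n : nat) (G : 'M[quat R]_(n.+1) -> Prop).
Local Notation H := (quat R).
Hypothesis subG : subgroup_Sp_n1 G.

(* The double annihilator of G under the real trace form; it is the real span
   of G, in a form which makes closedness under limits immediate. *)
Definition in_span (a : 'M[H]_n.+1) : Prop :=
  forall m, (forall g, G g -> rtr (g *m m) = 0) -> rtr (a *m m) = 0.

Lemma G_Sp g : G g -> in_Sp_n1 g. Proof. by case: subG => h _ _ _; apply: h. Qed.
Lemma G_1 : G 1%:M. Proof. by case: subG. Qed.
Lemma G_mul g h : G g -> G h -> G (g *m h). Proof. by case: subG => _ _ + _; apply. Qed.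
Lemma G_inv g : G g -> G (sp_inv g). Proof. by case: subG => _ _ _; apply. Qed.
Lemma G_mulV g : G g -> sp_inv g *m g = 1%:M.
Proof. by move/G_Sp/in_Sp_mulV. Qed.
Lemma G_mulmxV g : G g -> g *m sp_inv g = 1%:M.
Proof. by move/G_inv/G_Sp/in_Sp_mulmxV. Qed.

Lemma in_span_G g : G g -> in_span g. Proof. by move=> Gg m; apply. Qed.
Lemma in_spanD a b : in_span a -> in_span b -> in_span (a + b).
Proof. by move=> ha hb m hm; rewrite mulmxDl raddfD /= ha // hb // addr0. Qed.
Lemma in_span_real r a : in_span a -> in_span (qreal r *: a).
Proof. by move=> ha m hm; rewrite -scalemxAl rtr_qreal ha // mulr0. Qed.
(** The factors are replaced by group elements one at a time: cyclicity brings [g] and [h] next to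
    each other, and their product is again in G. *)
Lemma in_spanM a b : in_span a -> in_span b -> in_span (a *m b).
Proof.
move=> ha hb m hm; rewrite -mulmxA; apply: ha => g Gg.
rewrite rtr_mulC -mulmxA; apply: hb => h Gh.
by rewrite mulmxA rtr_mulC mulmxA hm //; exact: G_mul.
Qed.
Lemma in_span_inv a : in_span a -> in_span (sp_inv a).
Proof.
have rtr_inv (b c : 'M[H]_n.+1) : rtr (sp_inv b *m c) = rtr (b *m sp_inv c).
  rewrite -[in RHS]rtr_adj /sp_inv !qadjM qadjK qadj_Jq -!mulmxA.
  by rewrite rtr_mulC -!mulmxA rtr_mulC -!mulmxA.
move=> ha m hm; rewrite rtr_inv; apply: ha => g Gg.
by rewrite -rtr_inv; apply: hm; exact: G_inv.
Qed.
Lemma in_span_lim (F : set_system nat) {FF : ProperFilter F} a L :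
  mcvg F a L -> (forall k, in_span (a k)) -> in_span L.
Proof.
move=> aL ha m hm.
apply: (@real_cvg_uniq _ F _ (fun k => rtr (a k *m m))).
  by apply: cvg_rtr; apply: mcvgM aL (mcvg_cst _).
by under eq_fun do rewrite ha //; exact: cvg_cst.
Qed.

Hypothesis real_trace : forall q, trace_field G q -> is_qreal q.

(** Since Re(q tr g) = 0 for all [g] in G, the scalar matrix [q] lies in the annihilator that
    defines the span. *)
Lemma in_span_trace q a : qa q = 0 -> in_span a -> rtr (q%:M *m a) = 0.
Proof.
move=> q0 ha; rewrite rtr_mulC; apply: ha => g Gg.
rewrite rtr_mulC mul_scalar_mx /rtr mxtraceZ.
have /is_qrealP -> // : is_qreal (\tr g) by apply: real_trace => S _; apply.
Qed.

Lemma in_span_ro_trace q v w : qa q = 0 -> in_span (ro v w) -> qa (hf w (q *: v)) = 0.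
Proof. by move=> q0 h; rewrite -rtr_ro in_span_trace. Qed.

End SpanAlgebra.

Section BallModel.
Variables (R : realType) (n : nat).
Local Notation H := (quat R).
Local Notation e0 := (hvec (@origin R n)).

Lemma hvec_max (z : 'I_n -> H) : hvec z ord_max 0 = 1.
Proof. by rewrite mxE unlift_none. Qed.
Lemma hvec_widen (z : 'I_n -> H) i : hvec z (widen_ord (leqnSn n) i) 0 = z i.
Proof. by rewrite mxE -lift_max_widen liftK. Qed.
Lemma hvec_neq0 (z : 'I_n -> H) : hvec z != 0.
Proof.
apply: contra_eq_neq (hvec_max z) => ->.
by rewrite mxE eq_sym oner_neq0.
Qed.
Lemma hf_hvec (z : 'I_n -> H) : hf (hvec z) (hvec z) = qreal (qvnorm2 z - 1).
Proof.
rewrite hfE hvec_max qconj1 mulr1 (raddfB (@qreal R)) (raddf_sum (@qreal R)) /=; congr (_ - _).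
by apply: eq_bigr => i _; rewrite hvec_widen qconj_mul.
Qed.
Lemma hvec_origin : e0 = delta_mx ord_max 0.
Proof.
apply/matrixP => i j; rewrite ord1 [RHS]mxE eqxx andbT.
case: (unliftP ord_max i) => [k ->|->]; last by rewrite hvec_max eqxx.
rewrite lift_max_widen hvec_widen.
by have := ltn_ord k; rewrite ltn_neqAle -val_eqE /= => /andP[/negPf ->].
Qed.
Lemma hf_origin : hf e0 e0 = -1.
Proof.
rewrite hf_hvec /qvnorm2 big1 => [|i _]; first by rewrite sub0r raddfN.
exact: qnorm2_0.
Qed.
Lemma hf_hvec_origin z : hf (hvec z) e0 = -1.
Proof.
rewrite hfE !hvec_max qconj1 mulr1 big1 ?sub0r // => i _.
by rewrite [X in _ * X]hvec_widen mulr0.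
Qed.
Lemma mul_origin (g : 'M[H]_n.+1) i : (g *m e0) i 0 = g i ord_max.
Proof. by rewrite hvec_origin -colE mxE. Qed.

Lemma hf_coord_le (v : 'cV[H]_n.+1) i : i != ord_max ->
  qnorm2 (v i 0) <= qa (hf v v) + qnorm2 (v ord_max 0).
Proof.
case: (unliftP ord_max i) => [k -> _|->]; last by rewrite eqxx.
rewrite lift_max_widen hfE raddfB /= qconj_mul qa_real subrK raddf_sum /=.
rewrite (bigD1 k) //= qconj_mul qa_real lerDl.
by apply: sumr_ge0 => l _; rewrite qconj_mul qa_real qnorm2_ge0.
Qed.

Lemma Sp_col_le (g : 'M[H]_n.+1) i j : in_Sp_n1 g -> i != ord_max ->
  qnorm2 (g i j) <= (if j == ord_max then -1 else 1) + qnorm2 (g ord_max j).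
Proof.
move=> gS im; have := hf_coord_le (g *m delta_mx j 0) im.
rewrite hf_Sp // -colE !mxE; congr (_ <= _ + _).
rewrite /hf mxE (bigD1 j) //= big1 => [|k kj]; last first.
  by rewrite [X in _ * X]mxE (negPf kj) mulr0.
by rewrite addr0 Jq_mul !mxE !eqxx /= qconj1 mul1r mulr1; case: ifP.
Qed.

(** The corner entry controls the whole matrix: each column is bounded by its entry in the last row,
    and the same bound for the inverse, whose entries are conjugates up to sign, compares the last
    row with the corner. *)
Lemma Sp_entry_le (g : 'M[H]_n.+1) i j : in_Sp_n1 g -> in_Sp_n1 (sp_inv g) ->
  qnorm2 (g i j) <= 1 + qnorm2 (g ord_max ord_max).
Proof.
move=> gS gS'.
have invE k l : qnorm2 (sp_inv g k l) = qnorm2 (g l k).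
  rewrite Jq_mul mul_JqE mxE -qnorm2_conj.
  by do 2!case: ifP => _; rewrite ?mulN1r ?mulrN1 ?mulr1 ?mul1r ?raddfN ?opprK /= ?qnorm2N qconjK.
have rowle k : qnorm2 (g ord_max k) <= qnorm2 (g ord_max ord_max).
  have [->//|km] := eqVneq k ord_max.
  by have := Sp_col_le ord_max gS' km; rewrite eqxx !invE; lra.
have [->|im] := eqVneq i ord_max; first by have := rowle j; lra.
have := Sp_col_le j gS im; have := rowle j; case: ifP => _; lra.
Qed.

(** The corner entry [c] relates [g *m e0] to the standard lift of the image point. As the form
    keeps the value -1, the size of [c] measures how close that point is to the sphere. *)
Lemma Sp_act_origin (g : 'M[H]_n.+1) : in_Sp_n1 g ->
  let c := g ord_max ord_max in let z := act g (@origin R n) in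
  [/\ c != 0, g *m e0 = vs (hvec z) c & (1 - qvnorm2 z) * qnorm2 c = 1].
Proof.
move=> gS c z.
have gg : hf (g *m e0) (g *m e0) = -1 by rewrite hf_Sp // hf_origin.
have c0 : c != 0.
  rewrite /c -mul_origin; apply: hf_neg_last.
  by rewrite gg raddfN /= oppr_lt0 ltr01.
have gz : g *m e0 = vs (hvec z) c.
  apply/matrixP => i j; rewrite ord1 vsE.
  case: (unliftP ord_max i) => [k ->|->]; last by rewrite hvec_max mul1r mul_origin.
  by rewrite lift_max_widen hvec_widen /z /act -mulrA !mul_origin qmulVx // mulr1.
split=> //; move: gg; rewrite gz hf_vsl hf_vsr hf_hvec qrealC mulrA qconj_mul.
rewrite -rmorphM => /(congr1 (@qa R)); rewrite qa_real raddfN /= => h.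
have {}h : qnorm2 c * (qvnorm2 z - 1) = -1 by [].
by lra.
Qed.

Lemma converges_mcvg (F : set_system nat) {FF : Filter F} (u : nat -> 'I_n -> H) l :
  (forall N, F [set k | (N <= k)%N]) -> converges u l ->
  mcvg F (fun k => hvec (u k)) (hvec l).
Proof.
move=> FN ul i j; rewrite ord1.
case: (unliftP ord_max i) => [m ->|->]; last first.
  under [X in qcvg _ X _]eq_fun do rewrite hvec_max.
  by rewrite hvec_max; split; exact: cvg_cst.
under [X in qcvg _ X _]eq_fun do rewrite lift_max_widen hvec_widen.
rewrite lift_max_widen hvec_widen.
have near eps : 0 < eps -> F [set k | qnorm2 (u k m - l m) < eps ^+ 2].
  move=> e0; have [N hN] := ul (eps ^+ 2) (exprn_gt0 2 e0).
  apply: filterS (FN N) => k /= /hN; apply: le_lt_trans.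
  rewrite /qvnorm2 (bigD1 m) //= lerDl.
  by apply: sumr_ge0 => ? _; exact: qnorm2_ge0.
have conv (f : {additive H -> R}) : (forall x, f x ^+ 2 <= qnorm2 x) ->
    (fun k => f (u k m)) @ F --> f (l m).
  move=> hf2; apply/cvgrPdist_lt => eps e0; apply: filterS (near _ e0) => k /= h.
  rewrite distrC -raddfB -(@ltr_pXn2r _ 2) ?nnegrE // ?ltW // real_normK ?num_real //.
  exact: le_lt_trans (hf2 _) h.
by split; apply: conv => x; case: (qcoord_sqr_le x).
Qed.

End BallModel.

(** * Limit points and discreteness *)

Section LimitPoints.
Variables (R : realType) (n : nat) (G : 'M[quat R]_(n.+1) -> Prop).
Local Notation H := (quat R).
Local Notation e0 := (hvec (@origin R n)).
Hypothesis subG : subgroup_Sp_n1 G.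

Lemma real_cvg_le0 (F : set_system nat) {FF : ProperFilter F} (r : nat -> R) (l : R) :
  r @ F --> l -> (forall k, r k <= 0) -> l <= 0.
Proof.
move=> rl r0; rewrite leNgt; apply/negP => l0.
have /filter_ex [k] : F [set k | `|l - r k| < l] by move/cvgrPdist_lt: rl => /(_ l l0).
by rewrite /= ltr_norml => /andP[_]; have := r0 k; lra.
Qed.

Lemma limit_null xi : limit_set G xi -> hf (hvec xi) (hvec xi) = 0.
Proof. by case=> xi1 _; rewrite hf_hvec xi1 subrr raddf0. Qed.

(** Rescaled by [t k], the inverse norm of the corner entry, the [g k] are bounded and have a limit
    [L] whose corner entry has norm 1. As [t k] tends to 0, [sp_inv L *m L] and [L *m sp_inv L]
    vanish: the image of [L] is totally isotropic and contains a multiple of [x], so it is the line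
    of [x], and [y] is null. *)
Lemma limit_rank1 xi : limit_set G xi ->
  exists y, [/\ y != 0, hf y y = 0 & in_span G (ro (hvec xi) y)].
Proof.
move=> Lxi; have xx := limit_null Lxi; case: Lxi => _ [g [Gg gxi]].
set x := hvec xi in xx *.
have [U [UU UN]] := exists_ultra.
pose c k := g k ord_max ord_max; pose z k := act (g k) (@origin R n).
pose t k := (Num.sqrt (qnorm2 (c k)))^-1.
have zx : mcvg U (fun k => hvec (z k)) x by exact: converges_mcvg.
have actk k := Sp_act_origin (G_Sp subG (Gg k)).
have Nc k : 0 < qnorm2 (c k) by case: (actk k) => h _ _; rewrite qnorm2_gt0.
have tt k : t k ^+ 2 = - qa (hf (hvec (z k)) (hvec (z k))).
  have [_ _ h] := actk k.
  rewrite hf_hvec qa_real exprVn sqr_sqrtr ?(ltW (Nc k)) // -[LHS]mul1r -{1}h.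
  by rewrite mulfK ?(gt_eqF (Nc k)) // opprB.
have t0 k : t k ^+ 2 * qnorm2 (c k) = 1.
  by rewrite exprVn sqr_sqrtr ?(ltW (Nc k)) // mulVf ?(gt_eqF (Nc k)).
have tcv : (fun k => t k ^+ 2) @ U --> (0 : R).
  under eq_fun do rewrite tt; rewrite -oppr0 -(raddf0 (@qa R)) -xx.
  apply: cvgN; apply: cvg_qa; have := mcvgM (mcvgM (mcvg_adj zx) (mcvg_cst (Jq R n))) zx.
  exact.
pose T k := qreal (t k) *: g k.
(* The bound is [t k ^+ 2 * (1 + qnorm2 (c k)) = t k ^+ 2 + 1], where [t k ^+ 2 <= 1]. *)
have TC k i j : qnorm2 (T k i j) <= 2.
  rewrite mxE qnorm2M qnorm2_real.
  have := Sp_entry_le i j (G_Sp subG (Gg k)) (G_Sp subG (G_inv subG (Gg k))).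
  rewrite -/(c k); have [h0 _ h] := actk k.
  have h1 := qnorm2_ge0 (g k i j); have := t0 k; have := sqr_ge0 (t k) => h2 h3 h4.
  have h5 : 1 <= qnorm2 (c k).
    have : 0 <= qvnorm2 (z k) by apply: sumr_ge0 => ? _; exact: qnorm2_ge0.
    by have := Nc k; rewrite -/(c k) -/(z k) in h; nra.
  have : t k ^+ 2 * qnorm2 (g k i j) <= t k ^+ 2 * (1 + qnorm2 (c k)) by rewrite ler_wpM2l.
  nra.
have [L TL] := ultra_mcvg UU TC.
have LL : sp_inv L *m L = 0.
  apply: (mcvg_uniq (mcvgM (mcvg_sp_inv TL) TL)).
  have -> : (fun k => sp_inv (T k) *m T k) = (fun k => qreal (t k ^+ 2) *: 1%:M).
    apply/funext => k; rewrite sp_inv_real -scalemxAl scale_real (G_mulV subG) // scalerA.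
    by rewrite -rmorphM expr2.
  have := mcvg_scale (qcvg_qreal tcv) (@mcvg_cst R U _ _ _ (1%:M : 'M[H]_n.+1)).
  rewrite (raddf0 (@qreal R)) scale0r; exact.
have LL' : L *m sp_inv L = 0.
  apply: (mcvg_uniq (mcvgM TL (mcvg_sp_inv TL))).
  have -> : (fun k => T k *m sp_inv (T k)) = (fun k => qreal (t k ^+ 2) *: 1%:M).
    apply/funext => k; rewrite sp_inv_real -scalemxAl scale_real (G_mulmxV subG) // scalerA.
    by rewrite -rmorphM expr2.
  have := mcvg_scale (qcvg_qreal tcv) (@mcvg_cst R U _ _ _ (1%:M : 'M[H]_n.+1)).
  rewrite (raddf0 (@qreal R)) scale0r; exact.
pose gam := L ord_max ord_max.
have gam0 : gam != 0.
  rewrite -qnorm2_eq0; apply/eqP => g0.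
  have T1 : (fun k => qnorm2 (T k ord_max ord_max)) @ U --> (1 : R).
    by under eq_fun do rewrite mxE qnorm2M qnorm2_real t0; exact: cvg_cst.
  have : (1 : R) = qnorm2 gam by exact: real_cvg_uniq T1 (cvg_qnorm2 (TL _ _)).
  by move/eqP; rewrite g0 oner_eq0.
have Le : L *m e0 = vs x gam.
  apply: (mcvg_uniq (mcvgM TL (mcvg_cst e0))).
  have -> : (fun k => T k *m e0) = (fun k => hvec (z k) *m (T k ord_max ord_max)%:M).
    apply/funext => k; have [_ h _] := actk k.
    by rewrite -scalemxAl h -vs_real vsM mxE -qrealC.
  apply: mcvgM zx _ => i j; rewrite !ord1 mxE eqxx mulr1n.
  by under [X in qcvg _ X _]eq_fun do rewrite mxE eqxx mulr1n; exact: TL.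
have hfL u w : hf (L *m u) (L *m w) = 0.
  by rewrite hf_mul mulmxA LL mul0mx hf0r.
have Lx w : exists a, L *m w = vs x a.
  apply: hf_null_ortho => //; first exact: hvec_neq0.
  have /eqP := hfL e0 w; rewrite Le hf_vsl qmul_eq0 -qnorm2_eq0 qnorm2_conj qnorm2_eq0.
  by rewrite (negPf gam0) => /eqP.
(* Because [x] has last coordinate 1, the functional attached to [L] is its last row. *)
have Lro : L = ro x (Jq R n *m qadj (row ord_max L)).
  rewrite /ro qadjM qadjK qadj_Jq -!mulmxA JqK mulmx1.
  apply/matrixP => i j; rewrite [RHS]mxE big_ord1 [row _ _ _ _]mxE.
  have [a ha] := Lx (delta_mx j 0).
  have hm k : L k j = x k 0 * a.
    by have := congr1 (fun M : 'cV[H]_n.+1 => M k 0) ha; rewrite -colE mxE vsE.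
  by rewrite (hm i) (hm ord_max) hvec_max mul1r.
set y := Jq R n *m _ in Lro; exists y.
have Lspan : in_span G L.
  by apply: in_span_lim TL _ => k; apply: in_span_real; exact: in_span_G.
split; last by rewrite -Lro.
- apply: contra_neq gam0 => y0; rewrite /gam Lro y0 /ro raddf0 mulmx0 mul0mx.
  by rewrite mxE.
- have := congr1 (mulmxr e0) LL'.
  rewrite /= mul0mx Lro sp_inv_ro ro_ro ro_mulv vsM => /vs_eq0.
  rewrite (negPf (hvec_neq0 xi)) /= qmul_eq0 => /orP[/eqP //|].
  by rewrite hf_hvec_origin oppr_eq0 oner_eq0.
Qed.

(** On the orbit, [f] is its value at a standard lift times the fourth power of the norm of the
    corner entry. That entry tends to infinity, so a bound on the orbit forces the limit value to be
    at most 0. *)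
Lemma limit_le0 (f : 'cV[H]_n.+1 -> R) C xi : limit_set G xi ->
  (forall (U : set_system nat) v l, ProperFilter U -> mcvg U v l ->
     (fun k => f (v k)) @ U --> f l) ->
  (forall v a, f (vs v a) = f v * qnorm2 a ^+ 2) ->
  (forall g, G g -> f (g *m e0) <= C) -> f (hvec xi) <= 0.
Proof.
move=> Lxi fcv fh fC; have xx := limit_null Lxi; case: Lxi => _ [g [Gg gxi]].
have [U [UU UN]] := exists_ultra.
pose z k := hvec (act (g k) (@origin R n)).
have zx : mcvg U z (hvec xi) by exact: converges_mcvg.
pose s k := - qa (hf (z k) (z k)).
have scv : (fun k => s k) @ U --> (0 : R).
  rewrite -oppr0 -(raddf0 (@qa R)) -xx; apply: cvgN; apply: cvg_qa.
  have := mcvgM (mcvgM (mcvg_adj zx) (mcvg_cst (Jq R n))) zx; exact.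
have rcv : (fun k => f (z k) - C * (s k * s k)) @ U --> f (hvec xi) - C * (0 * 0).
  apply: cvgB; first exact: fcv.
  by apply: cvgM; [exact: cvg_cst|exact: cvgM].
have := real_cvg_le0 rcv; rewrite !mulr0 subr0; apply=> k.
have [c0 gz sc] := Sp_act_origin (G_Sp subG (Gg k)).
have := fC _ (Gg k); rewrite gz fh -/(z k).
have {}sc : s k * qnorm2 (g k ord_max ord_max) = 1.
  by rewrite /s /z hf_hvec qa_real opprB.
set N := qnorm2 _ in sc *; move=> h.
have : f (z k) * N ^+ 2 * (s k * s k) <= C * (s k * s k).
  by rewrite ler_wpM2r // -expr2 sqr_ge0.
suff -> : f (z k) * N ^+ 2 * (s k * s k) = f (z k) by lra.
rewrite -[RHS]mulr1 -[in RHS](mulr1 1) -{1 2}sc; ring.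
Qed.

Lemma limit_two_lines (y z : 'cV[H]_n.+1) C xi : limit_set G xi ->
  (forall g, G g -> qnorm2 (hf y (g *m e0)) * qnorm2 (hf z (g *m e0)) <= C) ->
  (hf y (hvec xi) == 0) || (hf z (hvec xi) == 0).
Proof.
move=> Lxi hC; rewrite -2!qnorm2_eq0 -mulf_eq0 eq_le.
rewrite [X in _ && X]mulr_ge0 ?qnorm2_ge0 // andbT.
apply: (@limit_le0 (fun v => qnorm2 (hf y v) * qnorm2 (hf z v)) C) => //.
- move=> U v l UU vl; apply: cvgM; apply: cvg_qnorm2.
    have := mcvgM (mcvg_cst (qadj y *m Jq R n)) vl; exact.
  have := mcvgM (mcvg_cst (qadj z *m Jq R n)) vl; exact.
- by move=> v a; rewrite !hf_vsr !qnorm2M; ring.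
Qed.

Lemma null_ortho_hvec_inj (y : 'cV[H]_n.+1) (xi eta : 'I_n -> H) : y != 0 -> hf y y = 0 ->
  hf (hvec xi) (hvec xi) = 0 -> hf (hvec eta) (hvec eta) = 0 ->
  hf y (hvec xi) = 0 -> hf y (hvec eta) = 0 -> xi = eta.
Proof.
move=> y0 yy xx ee yx ye.
have [a ha] := hf_null_ortho y0 yy xx yx; have [b hb] := hf_null_ortho y0 yy ee ye.
have := congr1 (fun M : 'cV[H]_n.+1 => M ord_max 0) hb.
have := congr1 (fun M : 'cV[H]_n.+1 => M ord_max 0) ha.
rewrite !hvec_max !vsE => e1 e2.
have ab : a = b.
  have ym := hf_null_last yy y0.
  by rewrite -[a]mul1r -[b]mul1r -(qmulVx ym) -!mulrA -e1 -e2.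
by apply/funext => i; rewrite -hvec_widen ha ab -hb hvec_widen.
Qed.

(** The bound makes every limit point orthogonal to [y] or to [z], and a null vector is orthogonal
    only to the null vectors on its own line; so two of any three limit points coincide. *)
Lemma nonelementary_bounded (y z : 'cV[H]_n.+1) C : nonelementary G ->
  y != 0 -> hf y y = 0 -> z != 0 -> hf z z = 0 ->
  (forall g, G g -> qnorm2 (hf y (g *m e0)) * qnorm2 (hf z (g *m e0)) <= C) -> False.
Proof.
move=> [x1 [x2 [x3 [L1 L2 L3 [n12 n23 n13]]]]] y0 yy z0 zz hC.
have o1 := limit_two_lines L1 hC; have o2 := limit_two_lines L2 hC.
have o3 := limit_two_lines L3 hC.
have c1 := limit_null L1; have c2 := limit_null L2; have c3 := limit_null L3.
case/orP: o1 => /eqP o1; case/orP: o2 => /eqP o2; case/orP: o3 => /eqP o3.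
- exact: n12 (null_ortho_hvec_inj y0 yy c1 c2 o1 o2).
- exact: n12 (null_ortho_hvec_inj y0 yy c1 c2 o1 o2).
- exact: n13 (null_ortho_hvec_inj y0 yy c1 c3 o1 o3).
- exact: n23 (null_ortho_hvec_inj z0 zz c2 c3 o2 o3).
- exact: n23 (null_ortho_hvec_inj y0 yy c2 c3 o2 o3).
- exact: n13 (null_ortho_hvec_inj z0 zz c1 c3 o1 o3).
- exact: n12 (null_ortho_hvec_inj z0 zz c1 c2 o1 o2).
- exact: n12 (null_ortho_hvec_inj z0 zz c1 c2 o1 o2).
Qed.

(** Choose [k] with [sp_inv (a k) *m L] close to 1, then [l > k] with [sp_inv (a k) *m a l] close to
    1. The latter is in G, hence equal to 1. The limit [L] need not lie in G. *)
Lemma discrete_repeat (U : set_system nat) {UU : ProperFilter U} a L : discrete_set G ->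
  (forall N, U [set k | (N <= k)%N]) -> (forall k, G (a k)) -> mcvg U a L ->
  exists k l, (k < l)%N /\ a k = a l.
Proof.
move=> dG UN Ga aL; have [eps e0 heps] := dG _ (G_1 subG).
have near b : mcvg U b (1%:M : 'M[H]_n.+1) -> U [set k | mxdist2 (b k) 1%:M < eps].
  move=> /(cvg_mxdist2 (M := 1%:M)) /cvgrPdist_lt /(_ _ e0).
  apply: filterS => k /=.
  have -> : mxdist2 1%:M (1%:M : 'M[H]_n.+1) = 0.
    by rewrite /mxdist2 big1 // => i _; rewrite big1 // => j _; rewrite subrr qnorm2_0.
  by rewrite sub0r normrN ltr_norml => /andP[].
have LL : sp_inv L *m L = 1%:M.
  apply: (mcvg_uniq (mcvgM (mcvg_sp_inv aL) aL)).
  have -> : (fun k => sp_inv (a k) *m a k) = (fun=> 1%:M).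
    by apply/funext => k; rewrite (G_mulV subG).
  exact: mcvg_cst.
have h1 : mcvg U (fun k => sp_inv (a k) *m L) 1%:M.
  by rewrite -LL; apply: mcvgM (mcvg_sp_inv aL) (mcvg_cst _).
have /filter_ex [k /= hk] := near _ h1.
have h3 : (fun l => mxdist2 (sp_inv (a k) *m a l) 1%:M) @ U --> mxdist2 (sp_inv (a k) *m L) 1%:M.
  by apply: cvg_mxdist2; apply: mcvgM (mcvg_cst _) aL.
pose d := mxdist2 (sp_inv (a k) *m L) 1%:M.
have h2 : U [set l | `|d - mxdist2 (sp_inv (a k) *m a l) 1%:M| < eps - d].
  by move/cvgrPdist_lt: h3; apply; rewrite subr_gt0.
have /filter_ex [l [/= hl kl]] : U ([set l | `|d - mxdist2 (sp_inv (a k) *m a l) 1%:M| < eps - d]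
    `&` [set l | (k.+1 <= l)%N]) by exact: filterI.
exists k, l; split=> //.
have Gkl : G (sp_inv (a k) *m a l) by apply: (G_mul subG) => //; exact: (G_inv subG).
have akl : sp_inv (a k) *m a l = 1%:M.
  by apply: heps => //; move: hl; rewrite ltr_norml => /andP[]; rewrite /d; lra.
by rewrite -[a l]mul1mx -(G_mulmxV subG (Ga k)) -mulmxA akl mulmx1.
Qed.

End LimitPoints.

(** * Absence of invariant null lines *)

Section ExtendSp.
Variables (R : realType) (n : nat).
Local Notation H := (quat R).
Local Notation V := 'cV[quat R]_n.+1.

Lemma Jq_frame_leq m (F : 'M[H]_(n.+1, m.+1)) :
  qadj F *m Jq R n *m F = Jq R m -> (m <= n)%N.
Proof.
move=> FF; rewrite -ltnS; apply: (@left_inverse_leq _ _ _ F (Jq R m *m qadj F *m Jq R n)).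
by rewrite -!mulmxA (mulmxA (qadj F)) FF JqK.
Qed.

Lemma extend_Sp m (F : 'M[H]_(n.+1, m.+1)) : qadj F *m Jq R n *m F = Jq R m ->
  exists (e : (n - m + m.+1 = n.+1)%N) (E : 'M[H]_(n.+1, n - m)),
  let P := castmx (erefl _, e) (row_mx E F) in
  [/\ in_Sp_n1 P, in_Sp_n1 (sp_inv P), qadj E *m Jq R n *m F = 0 &
      qadj E *m Jq R n *m E = 1%:M].
Proof.
move=> FF; have mn := Jq_frame_leq FF.
have e : (n - m + m.+1 = n.+1)%N by rewrite addnS subnK.
have [E [EE EF]] := @complete_basis _ _ _ F (n - m) FF (eq_leq (subnK mn)).
exists e, E => P; have PS : in_Sp_n1 P.
  rewrite /in_Sp_n1 gram_castmx -[RHS](castmx_Jq R e); congr castmx.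
  rewrite qadj_row_mx mul_col_mx mul_col_row EE EF FF; congr block_mx.
  by rewrite gram_adj EF raddf0.
by split=> //; apply/in_Sp_mulmxV/qmulmx1C/in_Sp_mulV.
Qed.

Lemma Sp_transitive_neg (v : V) : hf v v = -1 ->
  exists P, [/\ in_Sp_n1 P, in_Sp_n1 (sp_inv P) & P *m hvec (@origin R n) = v].
Proof.
move=> vv; have FF : qadj v *m Jq R n *m v = Jq R 0.
  by rewrite hfM vv; apply/matrixP => i j; rewrite !mxE !ord1.
have [e [E [PS PS' _ _]]] := extend_Sp FF.
exists (castmx (erefl, e) (row_mx E v)); split=> //.
apply/matrixP => i j; rewrite ord1 mul_origin castmxE cast_ord_id mxE.
case: splitP => k /= hk; last by rewrite ord1.
by have := ltn_ord k; lia.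
Qed.

End ExtendSp.

Section NoFixedLine.
Variables (R : realType) (n : nat) (G : 'M[quat R]_(n.+1) -> Prop).
Local Notation H := (quat R).
Local Notation V := 'cV[quat R]_n.+1.
Local Notation e0 := (hvec (@origin R n)).
Hypothesis subG : subgroup_Sp_n1 G.

Lemma vs_inj (y : V) a b : y != 0 -> vs y a = vs y b -> a = b.
Proof.
move=> y0 /eqP; rewrite -subr_eq0 -vsNr -vsDr => /eqP /vs_eq0.
by rewrite (negPf y0) subr_eq0 => /eqP.
Qed.

Lemma eigen_inv h (y : V) s : G h -> y != 0 -> h *m y = vs y s ->
  s != 0 /\ sp_inv h *m y = vs y (qinv s).
Proof.
move=> Gh y0 hy; have s0 : s != 0.
  apply: contra_neq y0 => s0; rewrite -[y]mul1mx -(G_mulV subG Gh) -mulmxA hy.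
  by rewrite s0 vs0 mulmx0.
split=> //; rewrite -[y in LHS]vs1 -(qmulxV s0) -vsM -hy vs_mul mulmxA.
by rewrite (G_mulV subG Gh) mul1mx.
Qed.

(** A loxodromic element fixes a second null line. Invariance of <y, z> determines its multiplier
    [t] up to conjugacy; [z] is null because [t] does not have norm 1, and it is off the line of
    [y], where multipliers have the norm of [s]. *)
Lemma contracting_null h (y : V) s : G h -> y != 0 -> hf y y = 0 ->
  h *m y = vs y s -> 1 < qnorm2 s ->
  exists z t, [/\ z != 0, hf z z = 0, hf y z != 0, h *m z = vs z t &
    qnorm2 s * qnorm2 t = 1].
Proof.
move=> Gh y0 yy hy s1; have [s0 hy'] := eigen_inv Gh y0 hy.
pose t := qconj (qinv s).
have st : qnorm2 s * qnorm2 t = 1.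
  by rewrite qnorm2_conj -qnorm2M qmulxV // qnorm2_1.
have t1 : qnorm2 t < 1 by have := qnorm2_ge0 t; nra.
have [z z0 hz] : exists2 z : V, z != 0 & h *m z = vs z t.
  (* The range of v |-> h v - v t is contained in the kernel of Re <y, .>. *)
  apply: contrapT => noz.
  have [] := @rlinear_inj_surj R n.+1 (fun v => h *m v - vs v t) _ _ _ (vs e0 (qinv (hf y e0))).
  - by move=> u v; rewrite mulmxDr vsDl opprD addrACA.
  - by move=> r u; rewrite scale_real -vs_scale scalerBr.
  - move=> u /eqP; rewrite subr_eq0 => /eqP hu; apply/eqP/negPn/negP => u0.
    by apply: noz; exists u.
  move=> u hu; have := congr1 (fun w => qa (hf y w)) hu.
  rewrite hf_vsr qmulxV; last first.
    rewrite hfC -qnorm2_eq0 qnorm2_conj qnorm2_eq0 hfE hvec_max qconj1 mul1r big1 ?sub0r.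
      by rewrite oppr_eq0; exact: hf_null_last.
    by move=> i _; rewrite hvec_widen raddf0 mul0r.
  rewrite hfDr hfNr hf_vsr -[h]sp_invK -hf_mul hy' hf_vsl raddfB /= qaMC subrr.
  by rewrite (_ : qa 1 = 1) // => /eqP; rewrite eq_sym oner_eq0.
have zz : hf z z = 0.
  have := hf_Sp z z (G_Sp subG Gh); rewrite hz hf_vsl hf_vsr [hf z z]hf_diag_real.
  rewrite qrealC mulrA qconj_mul -rmorphM => /qreal_inj h1.
  by have -> : qa (hf z z) = 0 by nra.
exists z, t; split=> //.
apply/eqP => yz; have [a za] := hf_null_ortho y0 yy zz yz.
have a0 : a != 0 by apply: contra_neq z0 => a0; rewrite za a0 vs0.
move: hz; rewrite za vs_mul hy !vsM => /(vs_inj y0) /(congr1 (@qnorm2 R)).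
rewrite !qnorm2M mulrC; move: a0; rewrite -qnorm2_eq0 => /mulfI inj /inj.
by move=> e; move: s1 t1; rewrite e; lra.
Qed.

Lemma conj_power_repeat g h (y z : V) s t : discrete_set G -> G g -> G h ->
  hf y y = 0 -> hf z z = 0 -> hf y z != 0 -> h *m y = vs y s -> h *m z = vs z t ->
  qnorm2 s * qnorm2 t = 1 -> qnorm2 t <= 1 -> hf y (g *m y) = 0 ->
  exists k l, (k < l)%N /\
    sp_inv (h ^+ k) *m (g *m h ^+ k) = sp_inv (h ^+ l) *m (g *m h ^+ l).
Proof.
move=> dG Gg Gh yy zz yz hy hz st t1 gyy.
have Ghk k : G (h ^+ k).
  by elim: k => [|k IH]; [exact: G_1|rewrite exprS; apply: (G_mul subG)].
have hkv (w : V) r k : h *m w = vs w r -> h ^+ k *m w = vs w (r ^+ k).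
  move=> hw; elim: k => [|k IH]; first by rewrite !expr0 mul1mx vs1.
  by rewrite !exprSr -mulmxA hw vs_mul IH vsM.
(* The value -1/2 gives [y + z mu] the norm -1, so that it can be moved to the origin. *)
have [mu km] : exists mu, hf y z * mu = qreal (- 2^-1).
  by exists (qinv (hf y z) * qreal (- 2^-1)); rewrite mulrA qmulxV // mul1r.
pose v := y + vs z mu.
have vv : hf v v = -1.
  rewrite /v hfDl !hfDr !hf_vsl !hf_vsr yy zz mul0r mulr0 add0r addr0 km.
  rewrite (hfC z y) -qconjM km qconj_real -raddfD /= (_ : - 2^-1 - 2^-1 = -1); last by lra.
  by rewrite (raddfN (@qreal R)).
have [P [PS PS' Pe]] := Sp_transitive_neg vv.
pose a k := sp_inv (h ^+ k) *m (g *m h ^+ k).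
have Ga k : G (a k).
  by apply: (G_mul subG); [exact: (G_inv subG)|exact: (G_mul subG)].
(* Conjugation by [P] moves [v] to the origin, where the corner entry bounds all entries. *)
pose b k := sp_inv P *m (a k *m P).
pose K1 := qnorm2 (hf y (g *m z)); pose K2 := qnorm2 (hf z (g *m y)).
pose K3 := qnorm2 (hf z (g *m z)).
(* The factors 2 come from two uses of [qnorm2D_le]. *)
pose C := 2 * (2 * (K1 * qnorm2 mu + K2 * qnorm2 mu) + K3 * qnorm2 mu ^+ 2).
have bC k i j : qnorm2 (b k i j) <= 1 + C.
  have bS : in_Sp_n1 (b k).
    apply: in_Sp_n1M PS' _; apply: in_Sp_n1M _ PS.
    exact: (G_Sp subG (Ga k)).
  have bS' : in_Sp_n1 (sp_inv (b k)).
    by apply/in_Sp_mulmxV/qmulmx1C/in_Sp_mulV.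
  apply: le_trans (Sp_entry_le i j bS bS') _; rewrite lerD2l.
  have -> : qnorm2 (b k ord_max ord_max) = qnorm2 (hf v (a k *m v)).
    rewrite -Pe hf_mul (mulmxA (a k)) (mulmxA (sp_inv P)) -/(b k) (hfC e0) qnorm2_conj.
    have : hf (b k *m e0) e0 = - qconj (b k ord_max ord_max).
      rewrite -mul_origin hfE hvec_max mulr1 big1 ?sub0r // => l _.
      by rewrite hvec_widen mulr0.
    by move=> ->; rewrite qnorm2N qnorm2_conj.
  (* The entry is the pairing of [h^k v = y S + z T] with its image under [g]. The term in [y], [y]
     vanishes by [gyy], the mixed terms are bounded because the product of the norms of [S] and [T]
     is constant, and the last one because [T] does not grow. *)
  rewrite /a -(mulmxA (sp_inv _)) -hf_mul -mulmxA mulmxDr -(vs1 y) !vs_mul (hkv _ _ _ hy) (hkv _ _ _ hz) !vsM mulr1.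
  set S := s ^+ k; set T := t ^+ k * mu.
  have NS : qnorm2 S * qnorm2 T = qnorm2 mu.
    by rewrite /S /T qnorm2M !qnorm2X mulrA -exprMn st expr1n mul1r.
  have NT : qnorm2 T <= qnorm2 mu.
    rewrite /T qnorm2M qnorm2X -[leRHS]mul1r ler_wpM2r ?qnorm2_ge0 //.
    by rewrite exprn_ile1 ?qnorm2_ge0.
  clearbody S T; rewrite mulmxDr !vs_mul hfDl !hfDr !hf_vsl !hf_vsr gyy mul0r mulr0 add0r addrA.
  apply: le_trans (qnorm2D_le _ _) _; rewrite ler_pM2l // lerD //.
    apply: le_trans (qnorm2D_le _ _) _; rewrite ler_pM2l //.
    by rewrite !qnorm2M !qnorm2_conj -/K1 -/K2 -NS; rewrite le_eqVlt; apply/orP; left; apply/eqP; ring.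
  rewrite !qnorm2M qnorm2_conj -/K3 mulrCA ler_wpM2l ?qnorm2_ge0 // -expr2.
  by rewrite ler_pXn2r // nnegrE qnorm2_ge0.
have [U [UU UN]] := exists_ultra.
have [L bL] := ultra_mcvg UU bC.
apply: (discrete_repeat subG (L := P *m L *m sp_inv P) dG UN Ga).
have -> : a = (fun k => P *m b k *m sp_inv P).
  move/in_Sp_mulmxV: PS' => PP; apply/funext => k.
  by rewrite /b (mulmxA P) PP mul1mx -mulmxA PP mulmx1.
by apply: mcvgM (mcvg_cst _); apply: mcvgM (mcvg_cst _) bL.
Qed.

(** A repetition among the conjugates means that [g] commutes with some [h^d], [d > 0]. Then <z, g
    z> is multiplied by a factor of norm less than 1 while staying the same, so it is 0. *)
Lemma fixed_line_fixes_axis g h (y z : V) s t : discrete_set G -> G g -> G h ->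
  z != 0 -> hf y y = 0 -> hf z z = 0 -> hf y z != 0 -> h *m y = vs y s -> h *m z = vs z t ->
  qnorm2 s * qnorm2 t = 1 -> qnorm2 t < 1 -> hf y (g *m y) = 0 ->
  exists b, g *m z = vs z b.
Proof.
move=> dG Gg Gh z0 yy zz yz hy hz st t1 gyy.
have [k [l [kl e]]] := conj_power_repeat dG Gg Gh yy zz yz hy hz st (ltW t1) gyy.
have Ghk j : G (h ^+ j).
  by elim: j => [|j IH]; [exact: (G_1 subG)|rewrite exprS; apply: (G_mul subG)].
have hkz j : h ^+ j *m z = vs z (t ^+ j).
  elim: j => [|j IH]; first by rewrite !expr0 mul1mx vs1.
  by rewrite !exprSr -mulmxA hz vs_mul IH vsM.
have [d d0 ld] : exists2 d, (0 < d)%N & l = (d + k)%N.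
  by exists (l - k)%N; lia.
have comm : g *m h ^+ d = h ^+ d *m g.
  have hV j : h ^+ j *m sp_inv (h ^+ j) = 1%:M := G_mulmxV subG (Ghk j).
  have hD : h ^+ (d + k) = h ^+ d *m h ^+ k := exprD _ _ _.
  move: e; rewrite ld hD sp_invM -(mulmxA (sp_inv (h ^+ k)) (sp_inv (h ^+ d))).
  move/(congr1 (mulmx (h ^+ k))); rewrite !(mulmxA (h ^+ k) (sp_inv (h ^+ k))) !hV !mul1mx.
  move/(congr1 (mulmx (h ^+ d))); rewrite (mulmxA (h ^+ d) (sp_inv (h ^+ d))) hV mul1mx.
  move/(congr1 (mulmxr (sp_inv (h ^+ k)))) => /=.
  move: (sp_inv (h ^+ k)) (hV k) => Xi hXi.
  by rewrite !mulmxA -2!(mulmxA _ _ Xi) hXi !mulmx1 => ->.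
have gzn : hf (g *m z) (g *m z) = 0 by rewrite (hf_Sp _ _ (G_Sp subG Gg)).
apply: (hf_null_ortho z0 zz gzn).
have := hf_Sp z (g *m z) (G_Sp subG (Ghk d)).
rewrite mulmxA -comm -mulmxA hkz vs_mul hf_vsl hf_vsr => /(congr1 (@qnorm2 R)).
rewrite !qnorm2M qnorm2_conj !qnorm2X => h1.
have td : qnorm2 t ^+ d < 1 by rewrite exprn_ilt1 ?qnorm2_ge0 // -lt0n.
have td0 : 0 <= qnorm2 t ^+ d by rewrite exprn_ge0 ?qnorm2_ge0.
apply/eqP; rewrite -qnorm2_eq0; apply/eqP.
have := qnorm2_ge0 (hf z (g *m z)).
move: h1 td td0; set A := qnorm2 (hf z _); set B := _ ^+ d => h1 td td0 A0.
have : A * (1 - B * B) = 0 by lra.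
by move/eqP; rewrite mulf_eq0 => /orP[/eqP //|]; rewrite subr_eq0 => /eqP; nra.
Qed.

(** Suppose G fixes the line of [y]. Either some element has a multiplier larger than 1 there, and G
    fixes both ends of its axis with reciprocal norms of multipliers, or all multipliers have norm
    at most 1. In both cases a product of two pairings is bounded on the orbit of the origin. *)
Lemma no_fixed_line (y : V) : discrete_set G -> nonelementary G ->
  y != 0 -> hf y y = 0 -> exists2 g, G g & hf y (g *m y) != 0.
Proof.
move=> dG nG y0 yy; apply: contrapT => hn.
have fixn g : G g -> hf y (g *m y) = 0.
  by move=> Gg; apply/eqP/negPn/negP => h; apply: hn; exists g.
have fix_y g : G g -> exists a, g *m y = vs y a.
  move=> Gg; apply: hf_null_ortho => //; last exact: fixn.
  by rewrite (hf_Sp _ _ (G_Sp subG Gg)).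
have eval (w : V) g a : sp_inv g *m w = vs w a ->
    qnorm2 (hf w (g *m e0)) = qnorm2 a * qnorm2 (hf w e0).
  by move=> gw; rewrite -[g]sp_invK -hf_mul gw hf_vsl qnorm2M qnorm2_conj.
have [[h [s [Gh hy s1]]]|hs] :=
    pselect (exists h s, [/\ G h, h *m y = vs y s & 1 < qnorm2 s]).
  have [z [t [z0 zz yz hz st]]] := contracting_null Gh y0 yy hy s1.
  have t1 : qnorm2 t < 1 by have := qnorm2_ge0 t; nra.
  apply: (@nonelementary_bounded _ _ _ subG y z (qnorm2 (hf y e0) * qnorm2 (hf z e0))) => // g Gg.
  have Gi := G_inv subG Gg.
  have [a ha] := fix_y _ Gi.
  have [b hb] := fixed_line_fixes_axis dG Gi Gh z0 yy zz yz hy hz st t1 (fixn _ Gi).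
  rewrite (eval _ _ _ ha) (eval _ _ _ hb).
  have ab : qnorm2 a * qnorm2 b = 1.
    have := hf_Sp y z (G_Sp subG Gi); rewrite ha hb hf_vsl hf_vsr.
    move=> /(congr1 (@qnorm2 R)); rewrite !qnorm2M qnorm2_conj mulrCA -[RHS]mulr1.
    by apply: mulfI; rewrite qnorm2_eq0.
  by rewrite mulrACA ab mul1r.
apply: (@nonelementary_bounded _ _ _ subG y y (qnorm2 (hf y e0) * qnorm2 (hf y e0))) => // g Gg.
have [a ha] := fix_y _ (G_inv subG Gg).
have a1 : qnorm2 a <= 1.
  by rewrite leNgt; apply/negP => a1; apply: hs; exists (sp_inv g), a; split=> //; exact: (G_inv subG).
rewrite (eval _ _ _ ha); have := qnorm2_ge0 (hf y e0); have := qnorm2_ge0 a.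
by move=> *; rewrite mulrACA ler_piMl ?mulr_ge0 ?qnorm2_ge0 // mulr_ile1 ?qnorm2_ge0.
Qed.

End NoFixedLine.

(** * Orbits of null vectors under the span *)

Definition qi {R : realType} : quat R := Quat 0 1 0 0.
Definition qj {R : realType} : quat R := Quat 0 0 1 0.
Definition qk {R : realType} : quat R := Quat 0 0 0 1.

Section RankOneOrbit.
Variables (R : realType) (n : nat) (G : 'M[quat R]_(n.+1) -> Prop).
Local Notation H := (quat R).
Local Notation V := 'cV[quat R]_n.+1.
Local Notation A := (in_span G).
Hypothesis subG : subgroup_Sp_n1 G.
Hypothesis real_trace : forall q, trace_field G q -> is_qreal q.

Lemma qi_mul_qj : qi * qj = qk :> H.
Proof. by apply: quat_eqP; rewrite /qi /qj /qk qmulE /qmul /qa /qb /qc /qd; ring. Qed.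
Lemma qconj_qj_mul_qi : qconj qj * qi = qk :> H.
Proof.
by apply: quat_eqP; rewrite /qi /qj /qk qmulE /qmul /qconj /qa /qb /qc /qd; ring.
Qed.
Lemma qconj_qi_mul : qconj qi * qi = 1 :> H.
Proof.
by apply: quat_eqP; rewrite /qi qmulE /qmul /qconj /qa /qb /qc /qd; ring.
Qed.
Lemma qconj_qj_mul : qconj qj * qj = 1 :> H.
Proof.
by apply: quat_eqP; rewrite /qj qmulE /qmul /qconj /qa /qb /qc /qd; ring.
Qed.
Lemma qk_neq0 : qk != 0 :> H.
Proof. by apply/eqP => /(congr1 (@qd R)) /eqP; rewrite oner_eq0. Qed.

Lemma hf_scale2 (p q : H) (v w : V) : hf (p *: v) (q *: w) = hf v ((qconj p * q) *: w).
Proof. by rewrite hf_scale scalerA. Qed.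

Definition orbit_span (x w : V) := exists2 a, A a & w = a *m x.

Lemma orbit_self x : orbit_span x x.
Proof. by exists 1%:M; [apply/in_span_G/(G_1 subG)|rewrite mul1mx]. Qed.
Lemma orbitD x v w : orbit_span x v -> orbit_span x w -> orbit_span x (v + w).
Proof. by move=> [a ha ->] [b hb ->]; exists (a + b); [exact: in_spanD|rewrite mulmxDl]. Qed.
Lemma orbit_real x r v : orbit_span x v -> orbit_span x (qreal r *: v).
Proof. by move=> [a ha ->]; exists (qreal r *: a); [exact: in_span_real|rewrite scalemxAl]. Qed.
Lemma orbitN x v : orbit_span x v -> orbit_span x (- v).
Proof. by move=> h; rewrite -scaleN1r -[-1 : H](raddfN (@qreal R) 1); exact: orbit_real. Qed.
Lemma orbitM x a v : A a -> orbit_span x v -> orbit_span x (a *m v).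
Proof. by move=> ha [b hb ->]; exists (a *m b); [exact: (in_spanM subG)|rewrite mulmxA]. Qed.
Lemma orbitG x g v : G g -> orbit_span x v -> orbit_span x (g *m v).
Proof. by move=> Gg; apply: orbitM; exact: in_span_G. Qed.

(** Multiplying the given operator by [a] on the left and by the adjoint of [b] on the right spreads
    it from [x] to all pairs in the orbit span. *)
Lemma orbit_ro x u w w' : A (ro (vs x u) x) -> orbit_span x w -> orbit_span x w' ->
  A (ro (vs w u) w').
Proof.
move=> hx [a ha ->] [b hb ->].
rewrite -vs_mul -mul_ro -[b]sp_invK -ro_mul.
by do 2!apply: (in_spanM subG) => //; exact: (in_span_inv subG).
Qed.

(** This makes values of the form act on the orbit span from the right, so that a single unexpected
    value acts on all its vectors. *)
Lemma orbit_closed x u w w1 w2 : A (ro (vs x u) x) -> orbit_span x w ->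
  orbit_span x w1 -> orbit_span x w2 -> orbit_span x (vs w (u * hf w1 w2)).
Proof.
move=> hx hw h1 h2; rewrite -vsM -ro_mulv.
exact: orbitM (orbit_ro hx hw h1) h2.
Qed.

Lemma orbit_trace x u q w w' : A (ro (vs x u) x) -> qa q = 0 ->
  orbit_span x w -> orbit_span x w' -> qa (hf w' (q *: w) * u) = 0.
Proof.
move=> hx q0 hw hw'; rewrite -hf_vsr -vs_scale.
by apply: (in_span_ro_trace real_trace) (orbit_ro hx hw hw').
Qed.

Lemma orbit_vs_im x v w r : orbit_span x (vs w v) -> orbit_span x w ->
  orbit_span x (vs w (v - qreal r)).
Proof.
by move=> hv hw; rewrite vsDr vsNr vs_real; apply: orbitD => //; apply: orbitN; exact: orbit_real.
Qed.

(** * Real coefficient: the form is real on the orbit span *)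

Section Case1.
Variables (x : V) (g : 'M[H]_n.+1).
Hypotheses (xx : hf x x = 0) (hx : A (ro x x)) (Gg : G g).
Hypothesis xgx : hf x (g *m x) != 0.

Let hx1 : A (ro (vs x 1) x). Proof. by rewrite vs1. Qed.
Let x' := g *m x.
Let xx' : hf x' x' = 0. Proof. by rewrite (hf_Sp _ _ (G_Sp subG Gg)). Qed.
Let Wx : orbit_span x x := orbit_self x.
Let Wx' : orbit_span x x'. Proof. exact: orbitG. Qed.

Lemma orbit_neg : exists2 w, orbit_span x w & qa (hf w w) < 0.
Proof.
exists (x - vs x' (hf x' x)).
  by apply: orbitD => //; apply: orbitN; rewrite -[hf x' x]mul1r; exact: orbit_closed.
rewrite hf_plane_neg // qa_real.
have : 0 < qnorm2 (hf x x') by rewrite qnorm2_gt0.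
by lra.
Qed.

(* If the form took a nonreal value on the orbit span, some imaginary v would
   act on it from the right, every <w, q w> with q imaginary would anticommute
   with v, and w, iw, jw, kw would span too many negative directions. *)
Lemma orbit_form_real w1 w2 : orbit_span x w1 -> orbit_span x w2 -> is_qreal (hf w1 w2).
Proof.
move=> h1 h2; pose v := hf w1 w2 - qreal (qa (hf w1 w2)).
have [v0|v0] := eqVneq v 0.
  by apply/eqP; rewrite -subr_eq0; apply/eqP.
have av : qa v = 0 by rewrite /v raddfB /= qa_real subrr.
have Wv w : orbit_span x w -> orbit_span x (vs w v).
  move=> hw; apply: orbit_vs_im => //.
  by rewrite -[hf w1 w2]mul1r; exact: orbit_closed.
clearbody v; have [w Ww wneg] := orbit_neg.
(* The trace condition for [w] makes <w, q w> imaginary, and the one for [w v] makes <w, q w> v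
   imaginary. *)
have anti q : qa q = 0 -> hf w (q *: w) * v = - (v * hf w (q *: w)).
  move=> q0; apply: qanticommP => //.
    by rewrite -[hf _ _]mulr1; exact: (orbit_trace hx1).
  rewrite -hf_vsr -vs_scale -[hf _ _]mulr1; apply: (orbit_trace hx1) => //.
  exact: Wv.
have [[ai aj] ak] := (anti qi erefl, anti qj erefl, anti qk erefl).
set al := hf w (qi *: w) in ai; set be := hf w (qj *: w) in aj.
set ga := hf w (qk *: w) in ak.
have al0 : al != 0.
  apply/eqP => al0; have [+ _] := hf_neg_ortho wneg al0.
  by rewrite hf_scale2 qconj_qi_mul scale1r leNgt wneg.
have [c alc] : exists c, al * c = be.
  by exists (qinv al * be); rewrite mulrA qmulxV // mul1r.
have cv : c * v = v * c.
  have /eqP : al * (c * v - v * c) = 0.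
    by rewrite mulrBr !mulrA alc ai aj mulNr -mulrA alc subrr.
  by rewrite qmul_eq0 (negPf al0) subr_eq0 => /eqP.
have gac : qa (ga * c) = 0.
  by apply: (qanticomm_qa v0); rewrite -mulrA cv mulrA ak mulNr mulrA.
(* The vector j w - i w c is orthogonal to the negative [w], yet its mixed terms are imaginary by
   [gac], so its norm is (1 + |c|^2) <w, w> < 0. *)
have wz : hf w (qj *: w - vs (qi *: w) c) = 0.
  by rewrite hfDr hfNr hf_vsr -/al -/be alc subrr.
have [+ _] := hf_neg_ortho wneg wz.
rewrite hfDl !hfDr !hfNl !hfNr !hf_vsl !hf_vsr.
have -> : hf (qi *: w) (qj *: w) = qconj ga.
  by rewrite hfC hf_scale2 qconj_qj_mul_qi.
rewrite !hf_scale2 qconj_qj_mul qconj_qi_mul qconj_qj_mul_qi !scale1r -/ga.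
rewrite !raddfD !raddfN /= !raddfN /= -qconjM qa_conj gac [hf w w]hf_diag_real.
rewrite qrealC mulrA qconj_mul -rmorphM !qa_real.
have := qnorm2_ge0 c; nra.
Qed.

End Case1.

Lemma ro_coef_imag x r : ~ A (ro x x) -> A (ro (vs x r) x) -> qa r = 0.
Proof.
move=> nhx hr; apply/eqP/negPn/negP => r0; apply: nhx.
have hr' : A (ro (vs x (qconj r)) x).
  by rewrite -ro_vs -[ro x _]sp_inv_ro; exact: (in_span_inv subG hr).
have := in_spanD hr hr'; rewrite -roDl -vsDr qadd_conj vs_real ro_real.
move/(in_span_real (qa r + qa r)^-1); rewrite scalerA -rmorphM mulVf.
  by rewrite rmorph1 scale1r.
by rewrite -mulr2n mulrn_eq0.
Qed.

(** * Imaginary coefficients: the orbit span is a real plane *)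

Section Case2.
Variables (x : V) (u : H) (g : 'M[H]_n.+1).
Hypotheses (x0 : x != 0) (xx : hf x x = 0) (u0 : u != 0) (au : qa u = 0).
Hypotheses (hx : A (ro (vs x u) x)) (Gg : G g).
Hypothesis coef_imag : forall r, A (ro (vs x r) x) -> qa r = 0.
Hypothesis xgx : hf x (g *m x) != 0.

Let x' := g *m x.
Let xx' : hf x' x' = 0. Proof. by rewrite (hf_Sp _ _ (G_Sp subG Gg)). Qed.
Let Wx : orbit_span x x := orbit_self x.
Let Wx' : orbit_span x x'. Proof. exact: orbitG. Qed.
Let xgx' : hf x' x != 0.
Proof. by rewrite hfC -qnorm2_eq0 qnorm2_conj qnorm2_eq0. Qed.

Lemma orbit_coef_imag r : orbit_span x (vs x r) -> qa (r * u) = 0.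
Proof.
by move=> [a ha hr]; apply: coef_imag; rewrite -vsM hr -vs_mul -mul_ro; exact: (in_spanM subG).
Qed.

Let uu : u * u = qreal (- qnorm2 u).
Proof.
have := qconj_mul u; rewrite qconj_imag // mulNr => /eqP.
by rewrite eqr_oppLR -raddfN => /eqP.
Qed.

(** Since x u <w1, w2> stays in the orbit span, u <w1, w2> u is a coefficient, hence imaginary; its
    real part is -|u|^2 Re <w1, w2>. *)
Lemma orbit_form_imag w1 w2 : orbit_span x w1 -> orbit_span x w2 -> qa (hf w1 w2) = 0.
Proof.
move=> h1 h2; have := orbit_coef_imag (orbit_closed hx Wx h1 h2).
rewrite qaMC mulrA uu qa_realM => /eqP.
by rewrite mulf_eq0 oppr_eq0 qnorm2_eq0 (negPf u0) => /eqP.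
Qed.

(* If u <w1, w2> were not real, some imaginary v anticommuting with u would
   act on the orbit span from the right; comparing (ij)x with i(jx) then shows
   that the scalars relating kx to x and gx both commute and anticommute with v. *)
Lemma orbit_form_line w1 w2 : orbit_span x w1 -> orbit_span x w2 -> is_qreal (u * hf w1 w2).
Proof.
move=> h1 h2; pose v := u * hf w1 w2 - qreal (qa (u * hf w1 w2)).
have [v0|v0] := eqVneq v 0.
  by apply/eqP; rewrite -subr_eq0; apply/eqP.
have av : qa v = 0 by rewrite /v raddfB /= qa_real subrr.
have Wv w : orbit_span x w -> orbit_span x (vs w v).
  by move=> hw; apply: orbit_vs_im => //; exact: orbit_closed.
clearbody v.
have uv : u * v = - (v * u).
  by apply: qanticommP => //; rewrite qaMC; apply: orbit_coef_imag; exact: Wv.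
have form_anti w w' : orbit_span x w -> orbit_span x w' -> hf w w' * v = - (v * hf w w').
  move=> hw hw'; apply: qanticommP => //; first exact: orbit_form_imag.
  by rewrite -hf_vsr; apply: orbit_form_imag => //; exact: Wv.
(* The trace conditions for [w] and [w v] make <w', q w> orthogonal to [u] and [v * u], which leaves
   the span of 1 and [v]. *)
have trace_comm q w w' : qa q = 0 -> orbit_span x w -> orbit_span x w' ->
    hf w' (q *: w) * v = v * hf w' (q *: w).
  move=> q0 hw hw'; apply: (qcomm_orthoP v0 u0) => //; first exact: (orbit_trace hx).
  by rewrite -hf_vsr -vs_scale; apply: (orbit_trace hx) => //; exact: Wv.
have quot k l : k != 0 -> k * v = - (v * k) -> l * v = v * l ->
    exists2 a, k * a = l & a * v = - (v * a).
  move=> k0 kv lv; have [a ka] : exists a, k * a = l.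
    by exists (qinv k * l); rewrite mulrA qmulxV // mul1r.
  exists a => //; apply/eqP; rewrite -addr_eq0.
  have /eqP : k * (a * v + v * a) = 0.
    by rewrite mulrDr !mulrA ka lv kv mulNr -mulrA ka subrr.
  by rewrite qmul_eq0 (negPf k0).
(* The remainder [p] lies in the complement of the plane of [x] and [x'], where the form is
   definite. It vanishes because [q *: w] is null and the mixed terms of the plane part are products
   of three factors anticommuting with [v], hence imaginary. *)
have decomp q w : qa q = 0 -> orbit_span x w -> hf w w = 0 ->
    exists a b, [/\ q *: w = vs x a + vs x' b, a * v = - (v * a) & b * v = - (v * b)].
  move=> q0 hw ww.
  have [b hb bv] := quot _ _ xgx (form_anti _ _ Wx Wx') (trace_comm q _ _ q0 hw Wx).
  have [a ha xav] := quot _ _ xgx' (form_anti _ _ Wx' Wx) (trace_comm q _ _ q0 hw Wx').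
  exists a, b; split=> //; apply/eqP; rewrite -subr_eq0; apply/eqP.
  set p := q *: w - (vs x a + vs x' b).
  have xp : hf x p = 0.
    by rewrite /p hfDr hfNr hfDr !hf_vsr xx mul0r add0r hb subrr.
  have x'p : hf x' p = 0.
    by rewrite /p hfDr hfNr hfDr !hf_vsr xx' mul0r addr0 ha subrr.
  have [_] := hf_plane_ortho xx xx' xgx xp x'p; apply.
  have hqw : hf (q *: w) (q *: w) = 0.
    by rewrite hf_scale2 qconj_mul -vs_real hf_vsr ww mul0r.
  have ep : q *: w = p + (vs x a + vs x' b) by rewrite subrK.
  clearbody p; move: hqw; rewrite ep.
  rewrite !(hfDl, hfDr) !hf_vsl !hf_vsr xp x'p (hf_eq0C xp) (hf_eq0C x'p) xx xx'.
  rewrite !(mul0r, mulr0, addr0, add0r) => /(congr1 (@qa R)); rewrite !raddfD /=.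
  have aa : qconj a = - a by apply: qconj_imag; exact: (qanticomm_qa v0).
  have z1 : qa (qconj a * (hf x x' * b)) = 0.
    apply: (qanticomm_qa v0); rewrite aa !mulNr -!mulrA bv !mulrN.
    rewrite (mulrA (hf x x') v) (form_anti _ _ Wx Wx') mulNr mulrN opprK.
    by rewrite -mulrA !(mulrA a v) xav mulNr -!mulrA.
  have z2 : qa (qconj b * (hf x' x * a)) = 0.
    by rewrite -qa_conj !qconjM qconjK -hfC -mulrA.
  by rewrite z1 z2 !addr0.
have [aj [bj [ej ajv bjv]]] := decomp qj x erefl Wx xx.
have [ak [bk [ek akv bkv]]] := decomp qk x erefl Wx xx.
have [ai [bi [ei aiv biv]]] := decomp qi x erefl Wx xx.
have [ai' [bi' [ei' aiv' biv']]] := decomp qi x' erefl Wx' xx'.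
have comm2 a b : a * v = - (v * a) -> b * v = - (v * b) -> a * b * v = v * (a * b).
  by move=> av' bv'; rewrite -mulrA bv' mulrN !mulrA av' mulNr opprK.
have := ek; rewrite -qi_mul_qj -scalerA ej scalerDr !vs_scale ei ei' !vsDl !vsM => e.
have ha : ai * aj + ai' * bj = ak.
  have /(congr1 (hf x')) := e; rewrite !hfDr !hf_vsr xx' !mul0r !addr0 -mulrDr.
  by move/eqP; rewrite -subr_eq0 -mulrBr qmul_eq0 (negPf xgx') subr_eq0 => /eqP.
have hb : bi * aj + bi' * bj = bk.
  have /(congr1 (hf x)) := e; rewrite !hfDr !hf_vsr xx !mul0r !add0r -mulrDr.
  by move/eqP; rewrite -subr_eq0 -mulrBr qmul_eq0 (negPf xgx) subr_eq0 => /eqP.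
have ak0 : ak = 0.
  apply: (qcomm_anticomm_eq0 v0) => //.
  by rewrite -ha mulrDl mulrDr (comm2 _ _ aiv ajv) (comm2 _ _ aiv' bjv).
have bk0 : bk = 0.
  apply: (qcomm_anticomm_eq0 v0) => //.
  by rewrite -hb mulrDl mulrDr (comm2 _ _ biv ajv) (comm2 _ _ biv' bjv).
have kx0 : qk *: x = 0 by rewrite ek ak0 bk0 !vs0 addr0.
case/eqP: x0; rewrite -[x]scale1r -(qmulVx qk_neq0) -scalerA kx0 scaler0 //.
Qed.

(** The values <x, w> and <x, x'> lie on one real line, so their quotient is real. The remainder
    after projection is in the orbit span, where norms are both real and imaginary, hence 0, and it
    lies in a definite complement. *)
Lemma orbit_plane w : orbit_span x w ->
  exists r s, w = vs x (qreal r) + vs x' (qreal s).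
Proof.
move=> hw.
have quot k l : k != 0 -> is_qreal (u * k) -> is_qreal (u * l) -> exists r, k * qreal r = l.
  move=> k0 hk hl; have uk0 : u * k != 0 by rewrite qmul_eq0 negb_or u0.
  move: hk hl; rewrite /is_qreal; move: (qa (u * k)) (qa (u * l)) => r1 r2 hk hl.
  have r0 : r1 != 0 by apply: contra_neq uk0 => r0; rewrite hk r0 raddf0.
  exists (r1^-1 * r2); apply/eqP; rewrite -subr_eq0.
  have /eqP : u * (k * qreal (r1^-1 * r2) - l) = 0.
    by rewrite mulrBr mulrA hk hl -rmorphM mulrA mulfV // mul1r subrr.
  by rewrite qmul_eq0 (negPf u0).
have [s hs] := quot _ _ xgx (orbit_form_line Wx Wx') (orbit_form_line Wx hw).
have [r hr] := quot _ _ xgx' (orbit_form_line Wx' Wx) (orbit_form_line Wx' hw).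
exists r, s; apply/eqP; rewrite -subr_eq0; apply/eqP.
have Wp : orbit_span x (w - (vs x (qreal r) + vs x' (qreal s))).
  apply: orbitD => //; apply: orbitN; rewrite !vs_real.
  by apply: orbitD; exact: orbit_real.
have [] := @hf_plane_ortho R n x x' (w - (vs x (qreal r) + vs x' (qreal s))) xx xx' xgx.
- by rewrite hfDr hfNr hfDr !hf_vsr xx mul0r add0r hs subrr.
- by rewrite hfDr hfNr hfDr !hf_vsr xx' mul0r addr0 hr subrr.
by move=> _; apply; exact: orbit_form_imag.
Qed.

End Case2.

End RankOneOrbit.

(** * Block form and real orthonormal frames *)

Section BlockForm.
Variables (R : realType) (n : nat).
Local Notation H := (quat R).
Local Notation V := 'cV[quat R]_n.+1.
Local Notation J := (Jq R n).

Lemma castmx_mul (a b : nat) (e : a = b) (A B : 'M[H]_a) :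
  castmx (e, e) A *m castmx (e, e) B = castmx (e, e) (A *m B).
Proof. by case: b / e. Qed.
Lemma castmx_inj2 (a b : nat) (e : a = b) (A B : 'M[H]_a) :
  castmx (e, e) A = castmx (e, e) B -> A = B.
Proof. by case: b / e. Qed.

Lemma gram_Sp p q (g : 'M[H]_n.+1) (A : 'M[H]_(n.+1, p)) (B : 'M[H]_(n.+1, q)) :
  in_Sp_n1 g -> qadj (g *m A) *m J *m (g *m B) = qadj A *m J *m B.
Proof.
move=> gS; rewrite qadjM mulmxA -(mulmxA (qadj A)) -(mulmxA (qadj A)).
by rewrite (gS : qadj g *m J *m g = J).
Qed.

(** The span of [F] is invariant under [g] and under its inverse; by the second, via <F, g E> =
    <g^-1 F, E>, the complement spanned by [E] is invariant too. *)
Lemma block_conj m (F : 'M[H]_(n.+1, m.+1)) (e : (n - m + m.+1 = n.+1)%N)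
    (E : 'M[H]_(n.+1, n - m)) (P := castmx (erefl, e) (row_mx E F))
    (g : 'M[H]_n.+1) (C C' : 'M[H]_m.+1) :
  in_Sp_n1 P -> in_Sp_n1 (sp_inv P) -> qadj E *m J *m F = 0 ->
  qadj F *m J *m F = Jq R m -> in_Sp_n1 g ->
  g *m F = F *m C -> sp_inv g *m F = F *m C' ->
  qadj C *m Jq R m *m C = Jq R m /\ exists B, in_Sp B /\
    sp_inv P *m g *m P = castmx (e, e) (block_mx B 0 0 C).
Proof.
move=> PS PS' EF FF gS gF gF'.
have CC : qadj C *m Jq R m *m C = Jq R m.
  by rewrite -{1}FF !mulmxA -qadjM -gF -mulmxA -gF gram_Sp.
have FE : qadj F *m J *m (g *m E) = 0.
  have Jg : J *m g = qadj (sp_inv g) *m J.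
    by rewrite /sp_inv !qadjM qadjK qadj_Jq -!mulmxA JqK mulmx1.
  rewrite mulmxA -(mulmxA _ J) Jg mulmxA -qadjM gF' qadjM -!mulmxA (mulmxA _ J).
  by rewrite gram_adj EF raddf0 mulmx0.
pose B := qadj E *m J *m (g *m E).
have PgP : sp_inv P *m g *m P = castmx (e, e) (block_mx B 0 0 C).
  have : qadj P *m (J *m g) *m P = castmx (e, e) (block_mx B 0 0 (Jq R m *m C)).
    rewrite gram_castmx; congr castmx.
    rewrite qadj_row_mx mul_col_mx mul_col_row.
    rewrite !mulmxA -!(mulmxA _ g) FE gF !mulmxA EF FF mul0mx.
    by rewrite -/B /B mulmxA.
  move=> h; rewrite /sp_inv -!mulmxA (mulmxA (qadj P)) (mulmxA _ g) mulmxA.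
  rewrite -(mulmxA J) !mulmxA -(mulmxA (J *m qadj P)) -(mulmxA J (qadj P)).
  rewrite -(mulmxA J) h -[J in LHS](castmx_Jq R e) castmx_mul mulmx_block.
  by rewrite !mul1mx !mul0mx !mulmx0 !addr0 !add0r mulmxA JqK mul1mx.
split=> //; exists B; split=> //.
have : in_Sp_n1 (sp_inv P *m g *m P).
  by apply: in_Sp_n1M PS; exact: in_Sp_n1M.
rewrite PgP /in_Sp_n1 qadj_castmx -[J in RHS](castmx_Jq R e) -[X in _ *m X *m _](castmx_Jq R e).
rewrite !castmx_mul => /castmx_inj2; rewrite qadj_block_mx !raddf0 !mulmx_block.
rewrite !mulmx0 !mul0mx !addr0 mulmx1.
by case/eq_block_mx.
Qed.

End BlockForm.

Section RealFrame.
Variables (R : realType) (n : nat).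
Local Notation H := (quat R).
Local Notation V := 'cV[quat R]_n.+1.
Local Notation J := (Jq R n).
Variable W : V -> Prop.
Hypothesis WD : forall v w, W v -> W w -> W (v + w).
Hypothesis WZ : forall r v, W v -> W (qreal r *: v).
Hypothesis WR : forall v w, W v -> W w -> is_qreal (hf v w).

Definition real_span m (F : 'M[H]_(n.+1, m)) (w : V) :=
  exists c : 'cV[R]_m, w = F *m map_mx (@qreal R) c.

Lemma W_real_span m (F : 'M[H]_(n.+1, m.+1)) w :
  (forall j, W (col j F)) -> real_span F w -> W w.
Proof.
move=> WF [c ->].
have -> : F *m map_mx (@qreal R) c = \sum_j qreal (c j 0) *: col j F.
  apply/matrixP => i j; rewrite mxE summxE; apply: eq_bigr => k _.
  by rewrite !mxE ord1 qrealC.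
have W0 : W 0 by have := WZ 0 (WF 0); rewrite raddf0 scale0r.
by elim/big_ind: _ => // j _; exact: WZ.
Qed.

(** Gram-Schmidt in signature (m, 1): real values of the form give real coordinates, [Jr R m]
    corrects the sign of the negative direction, and the remainder is orthogonal to the negative
    last column, hence positive. *)
Lemma frame_step m (F : 'M[H]_(n.+1, m.+1)) w :
  qadj F *m J *m F = Jq R m -> (forall j, W (col j F)) -> W w -> ~ real_span F w ->
  exists F' : 'M[H]_(n.+1, m.+2), qadj F' *m J *m F' = Jq R m.+1 /\
    forall j, W (col j F').
Proof.
move=> FF WF Ww nw.
pose c : 'cV[R]_m.+1 := \col_j qa (hf (col j F) w).
have Fw : qadj F *m J *m w = map_mx (@qreal R) c.
  apply/matrixP => i j; rewrite ord1 !mxE -(WR (WF i) Ww) /hf !mxE.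
  apply: eq_bigr => k _; rewrite !Jq_mul !mxE //.
have JrE : Jq R m = map_mx (@qreal R) (Jr R m).
  apply/matrixP => i j; rewrite !mxE; do 2?case: ifP => _; rewrite ?raddf0 ?rmorph1 //.
  by rewrite raddfN.
pose p := F *m map_mx (@qreal R) (Jr R m *m c); pose v := w - p.
have Wv : W v.
  apply: WD => //; rewrite -scaleN1r -[-1 : H](raddfN (@qreal R) 1); apply: WZ.
  by apply: (W_real_span (F := F)) => //; eexists.
have Fv : qadj F *m J *m v = 0.
  by rewrite mulmxBr Fw /p mulmxA FF map_mxM -JrE mulmxA JqK mul1mx subrr.
have v0 : v != 0.
  apply/eqP => v0; apply: nw; exists (Jr R m *m c); apply/eqP.
  by rewrite -subr_eq0; apply/eqP.
clearbody v; pose l := col ord_max F.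
have ll : qa (hf l l) < 0.
  have -> : hf l l = (qadj F *m J *m F) ord_max ord_max.
    by rewrite /hf !mxE; apply: eq_bigr => k _; rewrite !Jq_mul !mxE.
  by rewrite FF mxE eqxx raddfN /= oppr_lt0 ltr01.
have lv : hf l v = 0.
  by rewrite /hf /l colE qadjM -!mulmxA (mulmxA _ J) Fv mulmx0 mxE.
have [vp v00] := hf_neg_ortho ll lv.
have {}vp : 0 < qa (hf v v) by rewrite lt_def vp andbT; apply: contra_neq v0.
pose v1 := qreal (Num.sqrt (qa (hf v v)))^-1 *: v.
have v11 : qadj v1 *m J *m v1 = 1%:M by rewrite hfM normalize_pos.
have Fv1 : qadj F *m J *m v1 = 0 by rewrite scale_real Fv scaler0.
(* The new vector goes in front, so that the negative one stays last. *)
rewrite -[m.+2]/(1 + m.+1)%N; exists (row_mx v1 F); split.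
  rewrite -(castmx_Jq R (erefl : 1 + m.+1 = m.+2)%N) castmx_id.
  rewrite qadj_row_mx mul_col_mx mul_col_row v11 Fv1 FF; congr block_mx.
  by rewrite gram_adj Fv1 raddf0.
move=> j; case: (split_ordP j) => k ->.
  by rewrite colKl col_id; exact: WZ.
by rewrite colKr.
Qed.

(** Frames in [W] grow from the normalized [l] until they span [W]; [Jq_frame_leq] bounds their
    size, and [k] counts the steps left. *)
Lemma real_frame l : W l -> qa (hf l l) < 0 ->
  exists m (F : 'M[H]_(n.+1, m.+1)), [/\ qadj F *m J *m F = Jq R m,
    forall j, W (col j F) & forall w, W w -> real_span F w].
Proof.
move=> Wl l0.
have grow k : forall m (F : 'M[H]_(n.+1, m.+1)), (n - m <= k)%N ->
    qadj F *m J *m F = Jq R m -> (forall j, W (col j F)) ->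
    exists m (F : 'M[H]_(n.+1, m.+1)), [/\ qadj F *m J *m F = Jq R m,
      forall j, W (col j F) & forall w, W w -> real_span F w].
  elim: k => [|k IH] m F nm FF WF.
    exists m, F; split=> // w Ww; apply: contrapT => nw.
    have [F' [vF _]] := frame_step FF WF Ww nw.
    have := Jq_frame_leq vF; lia.
  have [[w [Ww nw]]|all] := pselect (exists w, W w /\ ~ real_span F w).
    have [F' [vF Wv]] := frame_step FF WF Ww nw.
    by apply: (IH m.+1 F') => //; have := Jq_frame_leq vF; lia.
  exists m, F; split=> // w Ww; apply: contrapT => nw.
  by apply: all; exists w.
pose r := (Num.sqrt (- qa (hf l l)))^-1.
apply: (grow n 0 (qreal r *: l)); first by rewrite subn0.
  rewrite hfM -vs_real hf_vsl hf_vsr qconj_real -qrealC mulrA.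
  rewrite hf_diag_real /r -!rmorphM /= -expr2 exprVn.
  rewrite sqr_sqrtr; last by rewrite oppr_ge0 ltW.
  rewrite invrN mulNr mulVf ?lt_eqF // (raddfN (@qreal R)).
  by apply/matrixP => i j; rewrite !mxE !ord1.
by move=> j; rewrite ord1 col_id; exact: WZ.
Qed.

End RealFrame.

(** * The dichotomy *)

Section Conclusion.
Variables (R : realType) (n : nat) (G : 'M[quat R]_(n.+1) -> Prop).
Local Notation H := (quat R).
Local Notation V := 'cV[quat R]_n.+1.
Local Notation J := (Jq R n).
Local Notation A := (in_span G).
Hypothesis subG : subgroup_Sp_n1 G.
Hypothesis dG : discrete_set G.
Hypothesis nG : nonelementary G.
Hypothesis real_trace : forall q, trace_field G q -> is_qreal q.

Lemma exists_seed : exists (x : V) (k : H),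
  [/\ x != 0, hf x x = 0, k != 0 & A (ro (vs x k) x)].
Proof.
case: nG => xi [_ [_ [Lxi _ _ _]]].
have [y [y0 yy hT]] := limit_rank1 subG Lxi.
have [g Gg k0] := no_fixed_line subG dG nG y0 yy.
exists (hvec xi), (hf y (g *m y)); split=> //; first exact: hvec_neq0.
  exact: limit_null Lxi.
have := in_spanM subG (in_spanM subG hT (in_span_G Gg)) (in_span_inv subG hT).
by rewrite sp_inv_ro -mulmxA mul_ro ro_ro.
Qed.

(** * Conjugation into Sp(n-m) + O(m,1) *)

Section RealCase.
Variable x : V.
Hypotheses (x0 : x != 0) (xx : hf x x = 0) (hx : A (ro x x)).

(** The rank-one element of [xi] maps [x] or [g *m x] to a nonzero multiple of [hvec xi]: the null
    vector [y] cannot be orthogonal to both, since the complement of their plane is definite. *)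
Lemma limit_lift g xi : G g -> hf x (g *m x) != 0 -> limit_set G xi ->
  exists w a, [/\ orbit_span G x w, a != 0 & w = vs (hvec xi) a].
Proof.
move=> Gg xgx Lxi; have [y [y0 yy hT]] := limit_rank1 subG Lxi.
have xx' : hf (g *m x) (g *m x) = 0 by rewrite (hf_Sp _ _ (G_Sp subG Gg)).
have lift w : orbit_span G x w -> hf y w != 0 ->
    exists w a, [/\ orbit_span G x w, a != 0 & w = vs (hvec xi) a].
  move=> hw yw; exists (ro (hvec xi) y *m w), (hf y w); split=> //.
    exact: (orbitM subG hT).
  exact: ro_mulv.
have [yx|yx] := eqVneq (hf y x) 0; last exact: lift (orbit_self subG x) yx.
have [yx'|yx'] := eqVneq (hf y (g *m x)) 0; last first.
  by apply: lift yx'; apply: (orbitG subG Gg); exact: (orbit_self subG).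
have [_] := hf_plane_ortho xx xx' xgx (hf_eq0C yx) (hf_eq0C yx').
by move=> y0'; case/eqP: y0; apply: y0'; rewrite yy.
Qed.

Lemma hf_real_frame m (F : 'M[H]_(n.+1, m.+1)) (c d : 'cV[R]_m.+1) :
  qadj F *m J *m F = Jq R m ->
  hf (F *m map_mx (@qreal R) c) (F *m map_mx (@qreal R) d)
  = hf (map_mx (@qreal R) c) (map_mx (@qreal R) d).
Proof.
move=> FF; rewrite /hf qadjM -!mulmxA (mulmxA J) (mulmxA (qadj F)) (mulmxA (qadj F)).
by rewrite FF.
Qed.

Lemma real_frame_dim g m (F : 'M[H]_(n.+1, m.+1)) : G g -> hf x (g *m x) != 0 ->
  qadj F *m J *m F = Jq R m -> (forall w, orbit_span G x w -> real_span F w) ->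
  (2 <= m)%N.
Proof.
move=> Gg xgx FF span.
have lift xi : limit_set G xi -> exists a (c : 'cV[R]_m.+1), a != 0 /\
    vs (hvec xi) a = F *m map_mx (@qreal R) c.
  move=> Lxi; have [w [a [hw a0 ew]]] := limit_lift Gg xgx Lxi.
  by have [c hc] := span _ hw; exists a, c; rewrite -ew.
case: nG => x1 [x2 [x3 [L1 L2 L3 [n12 n23 n13]]]].
have [a1 [c1 [a10 e1]]] := lift _ L1; have [a2 [c2 [a20 e2]]] := lift _ L2.
have [a3 [c3 [a30 e3]]] := lift _ L3.
have [[l1 l2] l3] := (limit_null L1, limit_null L2, limit_null L3).
pose b (c d : 'cV[R]_m.+1) := hf (map_mx (@qreal R) c) (map_mx (@qreal R) d).
have null xi a c : hf (hvec xi) (hvec xi) = 0 -> vs (hvec xi) a = F *m map_mx (@qreal R) c ->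
    b c c = 0.
  by move=> h e; rewrite /b -(hf_real_frame _ _ FF) -e hf_vsl hf_vsr h mul0r mulr0.
have indep xi eta a a' c c' : xi <> eta -> hf (hvec xi) (hvec xi) = 0 ->
    hf (hvec eta) (hvec eta) = 0 -> a != 0 -> a' != 0 ->
    vs (hvec xi) a = F *m map_mx (@qreal R) c ->
    vs (hvec eta) a' = F *m map_mx (@qreal R) c' -> b c c' <> 0.
  move=> ne h h' a0 a0' e e'; rewrite /b -(hf_real_frame _ _ FF) -e -e' hf_vsl hf_vsr.
  move/eqP; rewrite !qmul_eq0 -qnorm2_eq0 qnorm2_conj qnorm2_eq0 (negPf a0) (negPf a0') orbF /=.
  move/eqP => hh; apply: ne; apply: (@null_ortho_hvec_inj _ _ (hvec xi)) => //; exact: hvec_neq0.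
have := indep _ _ _ _ _ _ n12 l1 l2 a10 a20 e1 e2.
have := indep _ _ _ _ _ _ n23 l2 l3 a20 a30 e2 e3.
have := indep _ _ _ _ _ _ n13 l1 l3 a10 a30 e1 e3.
have := null _ _ _ l1 e1; have := null _ _ _ l2 e2; have := null _ _ _ l3 e3.
rewrite leqNgt /b; move: c1 c2 c3 {F FF span lift b e1 e2 e3 indep null}.
case: m => [|[|m]] // c1 c2 c3 h3 h2 h1 h13 h23 h12; exfalso.
  have bE (c d : 'cV[R]_1) : hf (map_mx (@qreal R) c) (map_mx (@qreal R) d) = qreal (- (c ord_max 0 * d ord_max 0)).
    by rewrite hfE big_ord0 sub0r !mxE qconj_real -rmorphM -raddfN.
  move: h1 h12; rewrite !bE => /eqP; rewrite (inj_eq (@qreal_inj R) _ 0).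
  by rewrite oppr_eq0 mulf_eq0 orbb => /eqP ->; rewrite mul0r oppr0.
have bE (c d : 'cV[R]_2) : hf (map_mx (@qreal R) c) (map_mx (@qreal R) d) =
    qreal (c (widen_ord (leqnSn 1) 0) 0 * d (widen_ord (leqnSn 1) 0) 0 - c ord_max 0 * d ord_max 0).
  by rewrite hfE big_ord1 !mxE !qconj_real -!rmorphM -raddfB.
move: h1 h2 h3 h12 h13 h23; rewrite !bE => /qreal_inj h1 /qreal_inj h2 /qreal_inj h3 h12 h13 h23.
have sgn (p q : R) : p * p - q * q = 0 -> p = q \/ p = - q.
  by move/eqP; rewrite subr_eq0 -!expr2 eqf_sqr => /orP[]/eqP; [left|right].
have aux (p q p' q' : R) : p * p' - q * q' = 0 -> qreal (p * p' - q * q') <> 0 -> False.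
  by move=> ->; rewrite raddf0.
(* A null vector of R^(1,1) has p = q or p = -q. Two of the three share the sign and are orthogonal,
   which distinct limit points exclude. *)
case: (sgn _ _ h1) => e1; case: (sgn _ _ h2) => e2; case: (sgn _ _ h3) => e3.
- by apply: aux h12; rewrite e1 e2; ring.
- by apply: aux h12; rewrite e1 e2; ring.
- by apply: aux h13; rewrite e1 e3; ring.
- by apply: aux h23; rewrite e2 e3; ring.
- by apply: aux h23; rewrite e2 e3; ring.
- by apply: aux h13; rewrite e1 e3; ring.
- by apply: aux h12; rewrite e1 e2; ring.
- by apply: aux h12; rewrite e1 e2; ring.
Qed.

Lemma real_case : exists m, (2 <= m)%N /\ conj_into G (@in_Sp_plus_O R n m).
Proof.
have [g Gg xgx] := no_fixed_line subG dG nG x0 xx.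
have [l Wl l0] := orbit_neg subG xx hx Gg xgx.
have WR v w : orbit_span G x v -> orbit_span G x w -> is_qreal (hf v w).
  by move=> hv hw; exact: (orbit_form_real subG real_trace xx hx Gg xgx hv hw).
have [m [F [FF WF span]]] := real_frame (@orbitD _ _ _ x) (@orbit_real _ _ _ x) WR Wl l0.
exists m; split; first exact: real_frame_dim Gg xgx FF span.
have [e [E [PS PS' EF EE]]] := extend_Sp FF.
set P := castmx _ _ in PS PS'.
have act h : G h -> exists C : 'M[R]_m.+1, h *m F = F *m map_mx (@qreal R) C.
  move=> Gh; have q j : exists c : 'cV[R]_m.+1, h *m col j F = F *m map_mx (@qreal R) c.
    by apply: span; exact: (orbitG subG Gh).
  have [c hc] := choice q.
  exists (\matrix_(i, j) c j i 0); apply/matrixP => i j.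
  have := congr1 (fun M : 'cV[H]_n.+1 => M i 0) (hc j).
  rewrite colE mulmxA -colE mxE => ->; rewrite !mxE; apply: eq_bigr => k _.
  by rewrite !mxE.
exists (sp_inv P); split=> // h Gh; rewrite sp_invK.
have [C hC] := act _ Gh; have [C' hC'] := act _ (G_inv subG Gh).
have [CC [B [BS hB]]] := block_conj PS PS' EF FF (G_Sp subG Gh) hC hC'.
exists e, B, C; split=> //.
have JrE : Jq R m = map_mx (@qreal R) (Jr R m).
  apply/matrixP => i j; rewrite !mxE; do 2?case: ifP => _; rewrite ?raddf0 ?rmorph1 //.
  by rewrite raddfN.
have adjE : qadj (map_mx (@qreal R) C) = map_mx (@qreal R) C^T.
  by apply/matrixP => i j; rewrite !mxE qconj_real.
move: CC; rewrite adjE JrE -!map_mxM => /matrixP CC; apply/matrixP => i j.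
by have := CC i j; rewrite !mxE => /qreal_inj.
Qed.

End RealCase.

Lemma scale_to_i (v : H) : qa v = 0 -> v != 0 ->
  exists mu, qconj mu * v * mu = qreal 2^-1 * qi.
Proof.
move=> av v0; pose r := Num.sqrt (qnorm2 v).
have r0 : 0 < r by rewrite sqrtr_gt0 qnorm2_gt0.
have rr : r * r = qnorm2 v by rewrite -expr2 sqr_sqrtr // qnorm2_ge0.
have ii : qi * qi = -1 :> H.
  by rewrite -(qconj_qi_mul R) qconj_imag // mulNr opprK.
have vv : v * v = qreal (- (r * r)).
  have := qconj_mul v; rewrite qconj_imag // mulNr rr => /eqP.
  by rewrite eqr_oppLR -raddfN => /eqP.
(* As [v] and [r i] have the same square, their sum intertwines them; it vanishes only for
   [v = - r i], which [j] conjugates to [r i]. *)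
have [m [m0 hm]] : exists m, m != 0 /\ v * m = m * (qreal r * qi).
  have [s0|s0] := eqVneq (v + qreal r * qi) 0; last first.
    exists (v + qreal r * qi); split=> //.
    rewrite mulrDl mulrDr vv addrC; congr (_ + _).
    by rewrite mulrA -(mulrA (qreal r) qi) -qrealC mulrA -rmorphM -mulrA ii mulrN1 raddfN.
  exists qj; split; first by apply/eqP => /(congr1 (@qc R)) /eqP; rewrite oner_eq0.
  move/eqP: s0; rewrite addr_eq0 => /eqP ->.
  have := congr1 (@qconj R) (qi_mul_qj R); rewrite qconjM !qconj_imag // mulrNN => ji.
  by rewrite mulNr -mulrA qi_mul_qj mulrA -qrealC -mulrA ji mulrN.
have Nm : 0 < qnorm2 m by rewrite qnorm2_gt0.
(* Chosen so that s^2 |m|^2 r = 1/2. *)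
pose s := Num.sqrt (2^-1 / (qnorm2 m * r)).
have ss : s * s = 2^-1 / (qnorm2 m * r).
  by rewrite -expr2 sqr_sqrtr // divr_ge0 ?mulr_ge0 ?invr_ge0 ?ltW.
exists (m * qreal s).
have -> : qconj (m * qreal s) * v * (m * qreal s) = qreal (s * (qnorm2 m * r * s)) * qi.
  rewrite qconjM qconj_real -!mulrA (mulrA v) hm -!mulrA (mulrA (qconj m)) qconj_mul.
  rewrite (mulrA (qreal r)) -(qrealC s (qreal r * qi)) !mulrA -!rmorphM.
  by congr (qreal _ * _); ring.
congr (qreal _ * _).
have -> : s * (qnorm2 m * r * s) = s * s * (qnorm2 m * r) by ring.
by rewrite ss mulfVK // gt_eqF // mulr_gt0.
Qed.

(** * Conjugation into Sp(n-1) + SU(1,1) *)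

Section SymplecticCase.
Variables (x : V) (u : H).
Hypotheses (x0 : x != 0) (xx : hf x x = 0) (u0 : u != 0) (au : qa u = 0).
Hypothesis hx : A (ro (vs x u) x).
Hypothesis coef_imag : forall r, A (ro (vs x r) x) -> qa r = 0.

(* With <y, y'> = i/2, the null basis y, y' is turned by a Cayley transform
   into the orthonormal basis y - y'i, y + y'i. *)
Lemma symplectic_case : conj_into G (@in_Sp_plus_SU11 R n).
Proof.
have [g0 Gg0 xgx] := no_fixed_line subG dG nG x0 xx.
pose x' := g0 *m x.
have xx' : hf x' x' = 0 by rewrite (hf_Sp _ _ (G_Sp subG Gg0)).
have Wx : orbit_span G x x := orbit_self subG x.
have Wx' : orbit_span G x x' := orbitG subG Gg0 Wx.
have ax : qa (hf x x') = 0 by exact: (orbit_form_imag subG u0 au hx coef_imag Wx Wx').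
have plane w : orbit_span G x w -> exists r s, w = vs x (qreal r) + vs x' (qreal s).
  exact: (orbit_plane subG real_trace x0 xx u0 au hx Gg0 coef_imag xgx).
have kn0 : hf x x' != 0 := xgx.
(* A common right factor [mu] keeps [x] and [x'] null and, as G acts on them with real coefficients,
   does not change the matrices; it normalizes the imaginary value <x, x'>. *)
have [mu hmu] := scale_to_i ax kn0.
have x'x : hf x' x = - hf x x' by rewrite hfC qconj_imag.
clearbody x'.
pose y := vs x mu; pose y' := vs x' mu.
have yy' : hf y y' = qreal 2^-1 * qi by rewrite /y /y' hf_vsl hf_vsr mulrA.
have y'y : hf y' y = - (qreal 2^-1 * qi).
  by rewrite /y /y' hf_vsl hf_vsr x'x mulNr mulrN mulrA hmu.
have yy : hf y y = 0 by rewrite /y hf_vsl hf_vsr xx mul0r mulr0.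
have y'y' : hf y' y' = 0 by rewrite /y' hf_vsl hf_vsr xx' mul0r mulr0.
have ii : qi * qi = -1 :> H.
  by rewrite -(qconj_qi_mul R) qconj_imag // mulNr opprK.
have hh : qreal 2^-1 + qreal 2^-1 = 1 :> H.
  by rewrite -rmorphD (_ : 2^-1 + 2^-1 = 1 :> R) ?rmorph1 //; lra.
have yi : hf y (vs y' qi) = - qreal 2^-1.
  by rewrite hf_vsr yy' -mulrA ii mulrN1.
have iy : hf (vs y' qi) y = - qreal 2^-1.
  by rewrite hfC yi raddfN /= qconj_real.
have iyyi : hf (vs y' qi) (vs y' qi) = 0.
  by rewrite hf_vsl hf_vsr y'y' mul0r mulr0.
pose f1 := y - vs y' qi; pose f2 := y + vs y' qi.
have f11 : hf f1 f1 = 1.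
  by rewrite /f1 hfDl !hfDr !hfNl !hfNr yy yi iy iyyi !(opprK, oppr0, add0r, addr0).
have f22 : hf f2 f2 = -1.
  by rewrite /f2 hfDl !hfDr yy yi iy iyyi !(add0r, addr0) -opprD hh.
have f12 : hf f1 f2 = 0.
  by rewrite /f1 /f2 hfDl !hfDr !hfNl yy yi iy iyyi !(opprK, oppr0, add0r, addr0) addNr.
pose F : 'M[H]_(n.+1, 1 + 1) := row_mx f1 f2.
have FF : qadj F *m J *m F = Jq R 1.
  rewrite /F qadj_row_mx mul_col_mx mul_col_row !hfM f11 f22 f12 (hf_eq0C f12).
  rewrite -(castmx_Jq R (erefl : 1 + 1 = 2)%N) castmx_id raddf0; congr block_mx.
  by apply/matrixP => i j; rewrite !mxE !ord1.
have [e [E [PS PS' EF EE]]] := extend_Sp FF.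
set P := castmx _ _ in PS PS'.
have act h : G h -> exists C : 'M[R[i]]_2, \det C = 1 /\ h *m F = F *m map_mx (@qcplx R) C.
  move=> Gh; have [a [c hxE]] := plane _ (orbitG subG Gh Wx).
  have [b [d hx'E]] := plane _ (orbitG subG Gh Wx').
  (* Invariance of <x, x'> is exactly determinant 1: the action on the plane is through SL(2, R). *)
  have det1 : a * d - b * c = 1.
    have := hf_Sp x x' (G_Sp subG Gh); rewrite hxE hx'E hfDl !hfDr !hf_vsl !hf_vsr.
    rewrite xx xx' x'x !qconj_real !(mul0r, mulr0, addr0, add0r) mulNr mulrN.
    rewrite -!qrealC !mulrA -!rmorphM -mulrBl => /eqP.
    rewrite -subr_eq0 -[X in _ - X]mul1r -mulrBl qmul_eq0 (negPf kn0) orbF subr_eq0.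
    by rewrite -rmorphB => /eqP /qreal_inj <-; ring.
  have hy : h *m y = vs y (qreal a) + vs y' (qreal c).
    by rewrite /y /y' vs_mul hxE vsDl !vsM !qrealC.
  have hy' : h *m y' = vs y (qreal b) + vs y' (qreal d).
    by rewrite /y /y' vs_mul hx'E vsDl !vsM !qrealC.
  clearbody y y'.
  (* By [comb] below, the first column (p, q) solves p + q = a - b i and i (q - p) = c - d i; the
     second solves the same equations with the signs of [b] and [d] reversed. *)
  pose c11 : R[i] := Complex ((a + d) / 2) ((c - b) / 2).
  pose c21 : R[i] := Complex ((a - d) / 2) (- (b + c) / 2).
  pose c12 : R[i] := Complex ((a - d) / 2) ((b + c) / 2).
  pose c22 : R[i] := Complex ((a + d) / 2) ((b - c) / 2).
  exists (block_mx (c11%:M : 'M_1) c12%:M c21%:M c22%:M); split.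
    pose C : 'M[R[i]]_2 := \matrix_(i, j)
      (if i == 0 then if j == 0 then c11 else c12 else if j == 0 then c21 else c22).
    have -> : block_mx (c11%:M : 'M_1) c12%:M c21%:M c22%:M = C.
      apply/matrixP => i j; rewrite !mxE.
      by case: splitP => k hk; rewrite !mxE; case: splitP => l hl;
        rewrite !mxE !ord1 -!val_eqE /= hk hl !ord1.
    rewrite (expand_det_row _ 0) !big_ord_recl big_ord0 /cofactor /= !det_mx11 !mxE /=.
    apply/eqP; rewrite eq_complex /=; apply/andP.
    by split; apply/eqP; [rewrite -[RHS]det1|]; field.
  have : h *m row_mx f1 f2 = row_mx f1 f2 *m block_mx ((qcplx c11)%:M : 'M_1)
      (qcplx c12)%:M (qcplx c21)%:M (qcplx c22)%:M; last first.
    by rewrite -!map_scalar_mx -map_block_mx; exact.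
  rewrite mul_mx_row mul_row_block.
  rewrite -![f1 *m _]/(vs f1 _) -![f2 *m _]/(vs f2 _).
  have comb (p q : H) : vs f1 p + vs f2 q = vs y (p + q) + vs y' (qi * (q - p)).
    rewrite /f1 /f2 !vsDl vsNl !vsM mulrBr !vsDr vsNr.
    by rewrite addrACA [- _ + _]addrC.
  have cE r s : qreal r + qreal s * qi = qcplx (Complex r s).
    have -> : qreal s * qi = qcplx (Complex 0 s).
      by apply: quat_eqP; rewrite /qi qmulE /qmul /qa /qb /qc /qd /=; ring.
    rewrite -[qreal r]/(qcplx (Complex r 0)) -rmorphD; congr qcplx.
    by apply/eqP; rewrite eq_complex /= addr0 add0r !eqxx.
  have rot (z : R[i]) : qi * qcplx z = qcplx (Complex (- complex.Im z) (complex.Re z)).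
    by case: z => p q; apply: quat_eqP; rewrite /qi qmulE /qmul /qa /qb /qc /qd /=; ring.
  rewrite !comb /f1 /f2 mulmxBr mulmxDr vs_mul hy hy' vsDl !vsM; congr row_mx.
    rewrite opprD addrACA -!vsNr -!vsDr -!mulNr -!raddfN !cE -!rmorphD rot.
    by congr (vs _ (qcplx _) + vs _ (qcplx _)); apply/eqP; rewrite eq_complex /=;
      apply/andP; split; apply/eqP; field.
  rewrite addrACA -!vsDr !cE -rmorphD -rmorphB rot.
  by congr (vs _ (qcplx _) + vs _ (qcplx _)); apply/eqP; rewrite eq_complex /=;
    apply/andP; split; apply/eqP; field.
exists (sp_inv P); split=> // h Gh; rewrite sp_invK.
have [C [Cdet hC]] := act _ Gh; have [C' [_ hC']] := act _ (G_inv subG Gh).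
have [CC [B [BS hB]]] := block_conj PS PS' EF FF (G_Sp subG Gh) hC hC'.
exists e, B, C; split=> //; split=> //.
have JcE : Jq R 1 = map_mx (@qcplx R) (Jc R).
  apply/matrixP => i j; rewrite !mxE; do 2?case: ifP => _; rewrite ?raddf0 ?rmorph1 //.
  by rewrite (raddfN (@qcplx R)).
have adjE : qadj (map_mx (@qcplx R) C) = map_mx (@qcplx R) (map_mx conjc C)^T.
  by apply/matrixP => i j; rewrite !mxE qconj_cplx.
move: CC; rewrite adjE JcE -!map_mxM => /matrixP CC; apply/matrixP => i j.
by have := CC i j; rewrite !mxE => /qcplx_inj.
Qed.

End SymplecticCase.

Lemma dichotomy : (exists m, (2 <= m)%N /\ conj_into G (@in_Sp_plus_O R n m))
  \/ conj_into G (@in_Sp_plus_SU11 R n).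
Proof.
have [x [k [x0 xx k0 hx]]] := exists_seed.
have [hx1|nhx] := pselect (A (ro x x)); first by left; exact: real_case x0 xx hx1.
right; have coef r : A (ro (vs x r) x) -> qa r = 0 := ro_coef_imag subG nhx.
exact: symplectic_case x0 xx k0 (coef _ hx) hx coef.
Qed.

End Conclusion.

Theorem theorem4p14 (R : realType) (n : nat) (G : 'M[quat R]_(n.+1) -> Prop) :
  subgroup_Sp_n1 G -> discrete_set G -> nonelementary G ->
  (forall q, trace_field G q -> is_qreal q) ->
  (exists m, (2 <= m)%N /\ conj_into G (@in_Sp_plus_O R n m))
  \/ conj_into G (@in_Sp_plus_SU11 R n).
Proof. exact: dichotomy. Qed.
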